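(* Let $G$ be a locally compact Abelian group with Haar measure $\lambda_G$, and let $\Omega\subset G$ be a closed neighbourhood of $0$ with $\lambda_G(\Omega)<\infty$. Then there exists $f\in\mathcal{G}_G(\Omega)$ with $\int_G f\,d\lambda_G=\mathcal{D}_G(\Omega)$ (an extremal function for $\mathcal{D}_G(\Omega)$). Moreover, there is a sequence $(f_n)_{n\in\mathbb{N}}$ in $\mathcal{G}_G(\Omega)$ with $\int_G f_n\,d\lambda_G\to\mathcal{D}_G(\Omega)$ that converges to $f$ uniformly on the compact subsets of $G$.
   Context: All locally compact Abelian groups are Hausdorff, with identity $0$. A function $f:G\to\mathbb{C}$ is positive definite if $\sum_{i,j=1}^n c_i\overline{c_j} f(g_i-g_j)\ge 0$ for all $n\in\mathbb{N}$, $c_i\in\mathbb{C}$, $g_i\in G$. $P_1(G)$ denotes the set of continuous positive definite functions $f:G\to\mathbb{R}$ with $f(0)=1$. For $f:G\to\mathbb{R}$, $f_+(g):=\max\{f(g),0\}$ and $\operatorname{supp} f:=\overline{\{g: f(g)\neq 0\}}$. Define $\mathcal{G}_G(\Omega):=\{f\in P_1(G)\cap L^1(G): \operatorname{supp} f_+\subset\Omega\}$ and $\mathcal{D}_G(\Omega):=\sup_{f\in\mathcal{G}_G(\Omega)}\int_G f\,d\lambda_G$. *)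

(* Defs.v *)
From HB Require Import structures.
From mathcomp Require Import all_boot all_order all_algebra.
From mathcomp Require Import complex.
From mathcomp Require Import all_classical all_reals all_analysis.
Set Implicit Arguments. Unset Strict Implicit. Unset Printing Implicit Defensive.
Import Order.TTheory GRing.Theory Num.Theory.
Import numFieldNormedType.Exports.
Local Open Scope classical_set_scope.
Local Open Scope ring_scope.

Definition pointedZ (G : zmodType) : Type := G.
HB.instance Definition _ (G : zmodType) := isPointed.Build (pointedZ G) 0.
Notation borelT G := (g_sigma_algebraType (@open G : set (set (pointedZ G)))).

Definition haar_measure (R : realType) (G : topologicalZmodType)
    (mu : {measure set (borelT G) -> \bar R}) : Prop :=
  [/\ (forall (x : G) (A : set (borelT G)), measurable A ->
          mu ((fun a : G => x + a) @` A) = mu A),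
      (forall K : set G, compact K -> (mu K < +oo)%E),
      (forall A : set (borelT G), measurable A ->
          mu A = ereal_inf [set mu U | U in [set U : set G | open U /\ A `<=` U]]),
      (forall U : set G, open U ->
          mu U = ereal_sup [set mu K | K in [set K : set G | compact K /\ K `<=` U]]) &
      (exists A : set (borelT G), measurable A /\ (0 < mu A)%E)].

Definition positive_definite (R : realType) (G : zmodType) (f : G -> R) : Prop :=
  forall (n : nat) (c : 'I_n -> R[i]) (g : 'I_n -> G),
    0 <= \sum_(i < n) \sum_(j < n) c i * (c j)^* * real_complex R (f (g i - g j)).

Definition P1 (R : realType) (G : topologicalZmodType) (f : G -> R) : Prop :=
  [/\ continuous f, positive_definite f & f 0 = 1].

Definition fplus (R : realType) (G : Type) (f : G -> R) : G -> R :=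
  fun g => Num.max (f g) 0.

Definition supp (R : realType) (G : topologicalType) (f : G -> R) : set G :=
  closure [set g | f g != 0].

Definition GG (R : realType) (G : topologicalZmodType)
    (mu : {measure set (borelT G) -> \bar R}) (Omega : set G) (f : G -> R) : Prop :=
  [/\ P1 f, mu.-integrable setT (fun x : borelT G => (f x)%:E)
      & supp (fplus f) `<=` Omega].

Definition DD (R : realType) (G : topologicalZmodType)
    (mu : {measure set (borelT G) -> \bar R}) (Omega : set G) : \bar R :=
  ereal_sup [set (\int[mu]_x (f x)%:E)%E | f in GG mu Omega].

(* Main.v *)
Require Import Defs.
From HB Require Import structures.
From mathcomp Require Import all_boot all_order all_algebra.
From mathcomp Require Import complex.
From mathcomp Require Import all_classical all_reals all_analysis.
From mathcomp Require Import measurable_realfun.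
From mathcomp Require Import ring lra.
Set Implicit Arguments. Unset Strict Implicit. Unset Printing Implicit Defensive.
Import Order.TTheory GRing.Theory Num.Theory.
Import numFieldNormedType.Exports.
Local Open Scope classical_set_scope.
Local Open Scope ring_scope.

(** A maximizing sequence [f] can be chosen Cauchy in L2: the functions of the
    class with nearly maximal integral form a convex set, and by the parallelogram
    law its elements of nearly minimal L2 norm are close to each other.

    Averaging [f m (x - s + t)] over [s] and [t] in a small neighbourhood [V] of 0
    preserves positive definiteness, dominates the error at every point by the error at 0
    ([f - smooth f] is again positive definite), and for a fixed [V] turns L2
    convergence into uniform convergence.  Alternating the choice of [V] and [m]
    gives averages [psi k] of [f (m k)] whose values at 0 are almost increasing and
    bounded by 1, so that they converge uniformly to a continuous positive definite
    [phi] with [phi 0 <= 1], while [psi k - f (m k)] tends to 0 in L2.  Double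
    averages over [V] are compared with finite ones instead of being treated as integrals
    over [G * G], because the Borel sets of [G * G] need not be generated by rectangles,
    so that Fubini's theorem is not available.

    Fatou's lemma shows that the integral of [phi] is at least the supremum.  As the
    supremum is positive, [phi / phi 0] is extremal.  The approximating sequence can
    then be taken constant. *)

(** * Positive definite functions *)

(** Evenness has to be required separately, because the real quadratic forms do not see the odd part
    of [f]. The forms run over any finite type, so that points may be indexed by pairs. *)
Definition real_pd (R : realType) (G : zmodType) (f : G -> R) : Prop :=
  (forall x, f (- x) = f x) /\
  forall (I : finType) (c : I -> R) (g : I -> G),
    0 <= \sum_i \sum_j c i * c j * f (g i - g j).

(** The list [P] stands for a finitely supported measure and [avg P k] for the integral of [k]
    against it; such integrals can be exchanged freely. *)
Definition avg (R : realType) (G : Type) (P : seq (R * G)) (k : G -> R) : R :=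
  \sum_(z <- P) z.1 * k z.2.

Definition prob_on (R : realType) (G : zmodType) (V : set G) (P : seq (R * G)) : Prop :=
  (forall z, z \in P -> 0 <= z.1 /\ V z.2) /\ avg P (fun=> 1) = 1.

(** When [L] is integration against a measure [nu], this is the convolution of [f] with [nu] and
    with the reflection of [nu]. The functional is a parameter so that finite averages and means
    over a set share one formula. *)
Definition smooth (R : realType) (G : zmodType) (L : (G -> R) -> R) (f : G -> R)
  (x : G) : R := L (fun s => L (fun t => f (x - s + t))).

Section positive_definite.
Context {R : realType} {G : zmodType}.
Implicit Types (f : G -> R) (P : seq (R * G)).

Lemma avgE P k :
  avg P k = \sum_(i < size P) (tnth (in_tuple P) i).1 * k (tnth (in_tuple P) i).2.
Proof. by rewrite /avg (big_tnth _ _ P). Qed.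

Lemma avgD P k l : avg P (fun s => k s + l s) = avg P k + avg P l.
Proof. by rewrite /avg -big_split; apply: eq_bigr => z _; rewrite /= mulrDr. Qed.

Lemma avgZ P a k : avg P (fun s => a * k s) = a * avg P k.
Proof. by rewrite /avg mulr_sumr; apply: eq_bigr => z _; rewrite mulrCA. Qed.

Lemma avgN P k : avg P (fun s => - k s) = - avg P k.
Proof. by rewrite /avg -sumrN; apply: eq_bigr => z _; rewrite mulrN. Qed.

Lemma avgB P k l : avg P (fun s => k s - l s) = avg P k - avg P l.
Proof. by rewrite avgD avgN. Qed.

Lemma eq_avg P k l : k =1 l -> avg P k = avg P l.
Proof. by move=> kl; apply: eq_bigr => z _; rewrite kl. Qed.

Lemma avg_cst V P a : prob_on V P -> avg P (fun=> a) = a.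
Proof.
move=> [_ P1]; have -> : (fun=> a) = (fun s : G => a * (fun=> 1) s).
  by apply/funext => s; rewrite mulr1.
by rewrite avgZ P1 mulr1.
Qed.

Lemma le_avg V P k l : prob_on V P -> (forall s, V s -> k s <= l s) ->
  avg P k <= avg P l.
Proof.
move=> [PV _] kl; rewrite /avg big_seq [leRHS]big_seq; apply: ler_sum => z /PV[z0 Vz].
by apply: ler_wpM2l => //; exact: kl.
Qed.

Lemma norm_avg_le V P k e : prob_on V P -> (forall s, V s -> `|k s| <= e) ->
  `|avg P k| <= e.
Proof.
move=> PV ke; rewrite ler_norml -{2}(avg_cst e PV) -(avg_cst (- e) PV).
by apply/andP; split; apply: (le_avg PV) => s /ke; rewrite ler_norml => /andP[].
Qed.

Lemma prob_on_sub U V P : U `<=` V -> prob_on U P -> prob_on V P.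
Proof. by move=> UV [PU P1]; split=> // z /PU[z0 /UV]. Qed.

Lemma avg_exchange P P' (k : G -> G -> R) :
  avg P (fun s => avg P' (k s)) = avg P' (fun t => avg P (k ^~ t)).
Proof.
rewrite /avg; under eq_bigr do rewrite mulr_sumr; rewrite exchange_big /=.
apply: eq_bigr => t _; rewrite mulr_sumr; apply: eq_bigr => s _.
by rewrite mulrCA.
Qed.

Lemma positive_definiteP f : positive_definite f <-> real_pd f.
Proof.
split=> [pf|[sf pf] n c g]; last first.
  (* The real and the imaginary parts of the weights each contribute a real form; the mixed terms
     cancel in the imaginary part by evenness. *)
  have -> : \sum_(i < n) \sum_(j < n) c i * (c j)^* * real_complex R (f (g i - g j)) =
     ((\sum_(i < n) \sum_(j < n) complex.Re (c i) * complex.Re (c j) * f (g i - g j)) +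
     (\sum_(i < n) \sum_(j < n) complex.Im (c i) * complex.Im (c j) * f (g i - g j)))%:C%C.
    set S := (_ + _); apply/eqP; rewrite eq_complex; apply/andP; split; apply/eqP.
      rewrite raddf_sum /= /S -big_split; apply: eq_bigr => i _ /=.
      rewrite raddf_sum /= -big_split; apply: eq_bigr => j _ /=.
      by case: (c i) => a b; case: (c j) => a' b' /=; ring.
    rewrite raddf_sum /=.
    have -> : \sum_(i < n) complex.Im (\sum_(j < n) c i * (c j)^* * real_complex R (f (g i - g j)))
      = \sum_(i < n) \sum_(j < n) complex.Im (c i) * complex.Re (c j) * f (g i - g j)
       - \sum_(i < n) \sum_(j < n) complex.Re (c i) * complex.Im (c j) * f (g i - g j).
      rewrite -sumrB; apply: eq_bigr => i _; rewrite raddf_sum /= -sumrB.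
      apply: eq_bigr => j _.
      by case: (c i) => a b; case: (c j) => a' b' /=; ring.
    apply/eqP; rewrite subr_eq0; apply/eqP; rewrite exchange_big /=.
    apply: eq_bigr => i _; apply: eq_bigr => j _.
    by rewrite -(sf (g j - g i)) opprB; ring.
  by rewrite lecR addr_ge0 //; exact: pf.
have sf x : f (- x) = f x.
  (* With weights [1] at [x] and [i] at [0] the form equals [2 f 0 + i (f (- x) - f x)]; being real,
     it forces evenness. *)
  have := pf 2%N (fun i => if i == ord0 then 1 else 'i%C)
    (fun i => if i == ord0 then x else 0).
  rewrite !big_ord_recl !big_ord0 /= !addr0 lecE /= => /andP[/eqP].
  rewrite !subrr !subr0 !sub0r /=; lra.
split=> // I c g.
have := pf #|I| (fun i => real_complex R (c (enum_val i))) (fun i => g (enum_val i)).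
have -> : \sum_(i < #|I|) \sum_(j < #|I|)
    real_complex R (c (enum_val i)) * (real_complex R (c (enum_val j)))^* *
    real_complex R (f (g (enum_val i) - g (enum_val j))) =
    (\sum_i \sum_j c i * c j * f (g i - g j))%:C%C.
  rewrite rmorph_sum /=.
  rewrite [RHS](reindex (enum_val : 'I_#|I| -> I)) /=; last first.
    by apply: onW_bij; exact: enum_val_bij.
  apply: eq_bigr => i _; rewrite rmorph_sum /=.
  rewrite [RHS](reindex (enum_val : 'I_#|I| -> I)) /=; last first.
    by apply: onW_bij; exact: enum_val_bij.
  apply: eq_bigr => j _; rewrite !rmorphM /=; congr (_ * _ * _).
  by apply/eqP; rewrite eq_complex /= oppr0 !eqxx.
by rewrite lecR.
Qed.

Lemma real_pd_seq f (s : seq (R * G)) : real_pd f ->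
  0 <= \sum_(y <- s) \sum_(z <- s) y.1 * z.1 * f (y.2 - z.2).
Proof.
move=> [_ pf]; rewrite (big_tnth _ _ s) /=.
under eq_bigr do rewrite (big_tnth _ _ s) /=.
exact: (pf _ (fun i => (tnth (in_tuple s) i).1) (fun i => (tnth (in_tuple s) i).2)).
Qed.

Lemma pd_norm_le f x : real_pd f -> `|f x| <= f 0.
Proof.
move=> pf; have [sf _] := pf; rewrite ler_norml; apply/andP; split.
  have := real_pd_seq [:: (1, x); (1, 0)] pf.
  rewrite !big_cons !big_nil /= !subrr subr0 sub0r sf; lra.
have := real_pd_seq [:: (1, x); (-1, 0)] pf.
rewrite !big_cons !big_nil /= !subrr subr0 sub0r sf; lra.
Qed.

(** This is Krein's inequality [|f x - f y|^2 <= 2 f 0 (f 0 - f (x - y))], adapted to a modulus of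
    continuity. It comes from the form at [x], [y], [0] with weights [k / e], [- k / e], [1] for
    [k = 1] and [k = -1]. *)
Lemma pd_modulus f e x y : real_pd f -> f 0 <= 1 -> 0 < e ->
  f 0 - f (x - y) <= e ^+ 2 / 2 -> `|f x - f y| <= e.
Proof.
move=> pf f01 e0 he; have [sf _] := pf.
have main k : 0 <= 2 * (k * e^-1) ^+ 2 * (f 0 - f (x - y)) + 2 * (k * e^-1) * (f x - f y) + f 0.
  have := real_pd_seq [:: (k * e^-1, x); (- (k * e^-1), y); (1, 0)] pf.
  rewrite !big_cons !big_nil /= !subrr !subr0 !sub0r !sf -(opprB x y) sf.
  by congr (_ <= _); ring.
have ek : e^-1 ^+ 2 * (f 0 - f (x - y)) <= 1 / 2.
  rewrite exprVn mulrC ler_pdivrMr ?exprn_gt0//.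
  by rewrite mulrC; lra.
have em z : e^-1 * z <= 1 -> z <= e by rewrite mulrC ler_pdivrMr// mul1r.
have m1 := main 1; have m2 := main (-1).
rewrite !exprMn sqrrN expr1n in m1 m2.
rewrite ler_norml lerNl; apply/andP; split; apply: em; nra.
Qed.

(** The weights [1, -1, k, -k] at [x, x + u, 0, u] are the convolution of [delta_x + k delta_0] with
    [delta_0 - delta_u]. For [k = 1] and [k = -1] the form is [4 (f 0 - f u)] plus [4 k] times the
    second difference. *)
Lemma pd_sym_diff f x u : real_pd f ->
  `|f x - (f (x + u) + f (x - u)) / 2| <= f 0 - f u.
Proof.
move=> pf; have [sf _] := pf.
have main k : k ^+ 2 = 1 ->
    0 <= 4 * (f 0 - f u) + k * 4 * (f x - (f (x + u) + f (x - u)) / 2).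
  move=> k1; have := real_pd_seq [:: (1, x); (-1, x + u); (k, 0); (- k, u)] pf.
  rewrite !big_cons !big_nil /= !subrr !subr0 !sub0r !sf.
  have -> : x - (x + u) = - u by rewrite opprD addNKr.
  have -> : x + u - x = u by rewrite addrC addKr.
  have -> : u - (x + u) = - x by rewrite opprD addrCA subrr addr0.
  rewrite addrK -(opprB x u) !sf.
  have e2 : k * k = 1 by rewrite -expr2.
  rewrite !mulrN !mulNr !mulr1 !mul1r !opprK e2; lra.
rewrite ler_norml; have := main 1; have := main (-1).
rewrite sqrrN expr1n => /(_ erefl) h1 /(_ erefl) h2; apply/andP; split; lra.
Qed.

(** A form of the smoothed function at the points [g i] is a form of [f] at the points [g i - s],
    with [s] running through [P] and the weights multiplied. *)
Lemma real_pd_smooth P f : real_pd f -> real_pd (smooth (avg P) f).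
Proof.
move=> [sf pf]; split=> [x|I c g].
  rewrite /smooth avg_exchange; apply: eq_avg => s; apply: eq_avg => t.
  by rewrite -(sf (x - s + t)); congr f; rewrite opprD opprB addrAC [s - x]addrC.
pose c' (z : I * 'I_(size P)) := c z.1 * (tnth (in_tuple P) z.2).1.
pose g' (z : I * 'I_(size P)) := g z.1 - (tnth (in_tuple P) z.2).2.
have := pf _ c' g'; have -> : \sum_y \sum_z c' y * c' z * f (g' y - g' z) =
    \sum_i \sum_a \sum_j \sum_b c' (i, a) * c' (j, b) * f (g' (i, a) - g' (j, b)).
  rewrite [RHS]pair_bigA; apply: eq_bigr => -[i a] _.
  by rewrite [RHS]pair_bigA; apply: eq_bigr => -[j b] _.
congr (_ <= _); apply: eq_bigr => i _.
rewrite exchange_big /=; apply: eq_bigr => j _.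
rewrite /smooth avgE mulr_sumr; apply: eq_bigr => a _.
rewrite avgE !mulr_sumr; apply: eq_bigr => b _; rewrite /c' /g' /=.
have -> : g i - (tnth (in_tuple P) a).2 - (g j - (tnth (in_tuple P) b).2) =
  g i - g j - (tnth (in_tuple P) a).2 + (tnth (in_tuple P) b).2.
  by rewrite opprB addrA addrAC; congr (_ + _); rewrite addrAC.
by ring.
Qed.

Lemma avg_smooth_norm_le V P f e : prob_on V P -> (forall x, `|f x| <= e) ->
  forall x, `|smooth (avg P) f x| <= e.
Proof.
move=> PV fe x; apply: (norm_avg_le PV) => s Vs.
by apply: (norm_avg_le PV) => t Vt; exact: fe.
Qed.

Lemma avg_smoothB P f g x :
  smooth (avg P) (fun y => f y - g y) x = smooth (avg P) f x - smooth (avg P) g x.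
Proof. by rewrite /smooth -avgB; apply: eq_avg => s; rewrite avgB. Qed.

Lemma avg_smooth_near V P f e x : prob_on V P ->
  (forall s t, V s -> V t -> `|f (x - s + t) - f x| <= e) ->
  `|smooth (avg P) f x - f x| <= e.
Proof.
move=> PV fe; rewrite /smooth -[X in `|_ - X|](avg_cst (f x) PV) -avgB.
apply: (norm_avg_le PV) => s Vs; rewrite -[X in `|_ - X|](avg_cst (f x) PV) -avgB.
by apply: (norm_avg_le PV) => t Vt; exact: fe.
Qed.

(* Averaging the displacements t - s and s - t together makes each term of
   f - smooth (avg P) f a second difference of f. *)
Lemma pd_sub_smooth V P f x : prob_on V P -> real_pd f ->
  `|f x - smooth (avg P) f x| <= f 0 - smooth (avg P) f 0.
Proof.
move=> PV pf; have [sf _] := pf.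
have symE y : smooth (avg P) f y =
    avg P (fun s => avg P (fun t => (f (y + (t - s)) + f (y - (t - s))) / 2)).
  have -> : (fun s => avg P (fun t => (f (y + (t - s)) + f (y - (t - s))) / 2)) =
    (fun s => 2^-1 * (avg P (fun t => f (y - s + t)) + avg P (fun t => f (y - t + s)))).
    apply/funext => s; rewrite -avgD -avgZ; apply: eq_avg => t.
    by rewrite mulrC opprB !addrA; congr (_ * (f _ + f _)); rewrite addrAC.
  by rewrite avgZ avgD [X in _ + X]avg_exchange /smooth; lra.
have subE y : f y - smooth (avg P) f y = avg P (fun s => avg P (fun t =>
    f y - (f (y + (t - s)) + f (y - (t - s))) / 2)).
  rewrite symE -[X in X - _](avg_cst (f y) PV) -avgB; apply: eq_avg => s.
  by rewrite -[X in X - _](avg_cst (f y) PV) -avgB.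
rewrite !subE ler_norml -avgN; apply/andP; split; apply: (le_avg PV) => s _;
  rewrite -?avgN; apply: (le_avg PV) => t _.
all: have := pd_sym_diff x (t - s) pf; rewrite add0r sub0r sf ler_norml => /andP[]; lra.
Qed.

Lemma real_pdD f g : real_pd f -> real_pd g -> real_pd (fun x => f x + g x).
Proof.
move=> [sf pf] [sg pg]; split=> [x|I c u]; first by rewrite sf sg.
under eq_bigr => i _ do (under eq_bigr => j _ do rewrite mulrDr; rewrite big_split).
by rewrite big_split addr_ge0.
Qed.

Lemma real_pdZ f a : 0 <= a -> real_pd f -> real_pd (fun x => a * f x).
Proof.
move=> a0 [sf pf]; split=> [x|I c u]; first by rewrite sf.
under eq_bigr => i _ do (under eq_bigr => j _ do rewrite mulrCA; rewrite -mulr_sumr).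
by rewrite -mulr_sumr mulr_ge0.
Qed.

Lemma real_pd_approx f :
  (forall e, 0 < e -> exists2 g, real_pd g & forall x, `|f x - g x| <= e) ->
  real_pd f.
Proof.
move=> fg; split=> [x|I c u].
  apply/eqP; rewrite -subr_eq0 -normr_le0; apply/ler_addgt0Pr => e e0.
  have [|g [sg _] gf] := fg (e / 2); first by rewrite divr_gt0.
  have := gf x; have := gf (- x); rewrite sg !ler_norml add0r => /andP[a b] /andP[a' b'].
  by apply/andP; split; lra.
apply/ler_addgt0Pr => e e0.
(* [S] bounds the change of the quadratic form per unit of uniform distance; the [+ 1] below avoids
   a zero denominator. *)
pose S := \sum_i \sum_j `|c i * c j|.
have S0 : 0 <= S by rewrite sumr_ge0// => i _; rewrite sumr_ge0.
have [|g [_ pg] gf] := fg (e / (S + 1)); first by rewrite divr_gt0// ltr_wpDl.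
apply: le_trans (pg I c u) _; rewrite -lerBlDl -sumrB.
apply: (@le_trans _ _ (\sum_i \sum_j `|c i * c j| * (e / (S + 1)))).
  apply: ler_sum => i _; rewrite -sumrB; apply: ler_sum => j _.
  rewrite -mulrBr (le_trans (ler_norm _))// normrM ler_wpM2l//.
  by rewrite distrC gf.
under eq_bigr do rewrite -mulr_suml.
rewrite -mulr_suml -/S mulrA ler_pdivrMr ?ltr_wpDl//.
by rewrite mulrDr mulr1 mulrC lerDl ltW.
Qed.

End positive_definite.

(** * Topological groups and Borel sets *)

(* [compact_cover] is only available for pointed topological types. *)
Lemma compact_finite_cover (T : topologicalType) (K : set T) (f : T -> set T) :
  compact K -> (forall x, K x -> nbhs x (f x)) ->
  exists2 s : seq T, {in s, forall x, x \in K} &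
    forall y, K y -> exists2 x, x \in s & f x y.
Proof.
move=> cK Kf; apply: contrapT => nocover.
(* [F] is generated by the complements in [K] of finite unions of the sets [f x]. Without a finite
   subcover it is a proper filter, and a cluster point [x] contradicts the neighbourhood [f x]. *)
pose F : set_system T := fun A => exists2 s : seq T, {in s, forall x, x \in K} &
  forall y, K y -> (forall x, x \in s -> ~ f x y) -> A y.
have FF : ProperFilter F.
  split; last split.
  - move=> [s sK sF]; apply: nocover; exists s => // y Ky.
    by apply: contrapT => nf; apply: (sF y Ky) => x xs fxy; apply: nf; exists x.
  - by exists [::].
  - move=> A B [s sK sA] [t tK tB]; exists (s ++ t).
      by move=> x; rewrite mem_cat => /orP[/sK|/tK].
    move=> y Ky nf; split; [apply: sA|apply: tB] => // x xs;
      by apply: nf; rewrite mem_cat xs ?orbT.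
  - by move=> A B AB [s sK sA]; exists s => // y Ky nf; exact/AB/sA.
have [|x [Kx clx]] := cK F FF; first by exists [::].
have Ff : F (K `\` f x).
  exists [:: x] => [y|y Ky nf]; first by rewrite mem_seq1 => /eqP ->; exact: mem_set.
  by split => //; apply: nf; rewrite mem_seq1.
by have [y [[_ nfy] fy]] := clx _ _ Ff (Kf x Kx).
Qed.

Section topological_group.
Context {R : realType} {G : topologicalZmodType}.
Implicit Types (f : G -> R) (N U V : set G).

Lemma translation_continuous (a : G) : continuous (fun y => a + y).
Proof.
move=> y; apply: (@continuous_comp _ _ _ (fun y => (a, y))
  (fun z : G * G => z.1 + z.2)); last exact: add_continuous.
by apply: cvg_pair; [exact: cvg_cst|exact: cvg_id].
Qed.

Lemma nbhs0_sub N : nbhs (0 : G) N ->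
  exists2 W, nbhs (0 : G) W & forall s t, W s -> W t -> N (t - s).
Proof.
move=> N0; have [|[A B] /= [A0 B0] AB] := @sub_continuous G (0, 0) N.
  by rewrite /= subr0.
exists (A `&` B); first exact: filterI.
by move=> s t [As Bs] [At Bt]; exact: (AB (t, s)).
Qed.

Lemma nbhs0_opp N : nbhs (0 : G) N -> nbhs (0 : G) [set x | N (- x)].
Proof. by move=> N0; apply: (@opp_continuous G 0); rewrite /= oppr0. Qed.

Lemma nbhs_translate (x : G) N : nbhs (0 : G) N -> nbhs x [set y | N (y - x)].
Proof.
move=> N0; have : nbhs x ((fun y => - x + y) @^-1` N).
  by apply: translation_continuous; rewrite /= addNr.
by apply: filterS => y /=; rewrite addrC.
Qed.

Definition unif_cont f := forall e : R, 0 < e ->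
  exists2 N, nbhs (0 : G) N & forall x u, N u -> `|f (x + u) - f x| <= e.

Lemma unif_cont_continuous f : unif_cont f -> continuous f.
Proof.
move=> uf x; apply/cvgrPdist_le => e /uf[N N0 fN].
apply: filterS (nbhs_translate x N0) => y /= /(fN x).
by rewrite [x + _]addrC subrK distrC.
Qed.

(** By Krein's inequality the increment [f (x + u) - f x] is controlled by [f 0 - f u] alone,
    whatever [x] is. *)
Lemma pd_unif_cont f : {for 0, continuous f} -> real_pd f -> f 0 <= 1 ->
  unif_cont f.
Proof.
move=> /cvgrPdist_le cf pf f01 e e0.
have := cf (e ^+ 2 / 2); rewrite divr_gt0 ?exprn_gt0// => /(_ isT) N0.
exists [set u | `|f 0 - f u| <= e ^+ 2 / 2] => // x u fu.
apply: pd_modulus => //; rewrite [x + u]addrC addrK.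
exact: le_trans (ler_norm _) fu.
Qed.

Lemma unif_cont_approx f :
  (forall e, 0 < e -> exists2 g, unif_cont g & forall x, `|f x - g x| <= e) ->
  unif_cont f.
Proof.
move=> fg e e0; have e3 : 0 < e / 3 by rewrite divr_gt0.
have [g /(_ _ e3)[N N0 gN] {}fg] := fg _ e3; exists N => // x u /(gN x) gxu.
have := fg (x + u); have := fg x.
move: gxu; rewrite !ler_norml => /andP[? ?] /andP[? ?] /andP[? ?].
by apply/andP; split; lra.
Qed.

Lemma unif_cont_smooth V P f : prob_on V P -> unif_cont f -> unif_cont (smooth (avg P) f).
Proof.
move=> PV uf e /uf[N N0 fN]; exists N => // x u Nu.
rewrite /smooth -avgB; apply: (norm_avg_le PV) => s _.
rewrite -avgB; apply: (norm_avg_le PV) => t _.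
by rewrite (addrAC x u) [x - s + u + t]addrAC; exact: fN.
Qed.

Lemma unif_contB f g : unif_cont f -> unif_cont g -> unif_cont (fun x => f x - g x).
Proof.
move=> uf ug e e0; have e2 : 0 < e / 2 by rewrite divr_gt0.
have [N N0 fN] := uf _ e2; have [M M0 gM] := ug _ e2.
exists (N `&` M); first exact: filterI.
move=> x u [/(fN x) + /(gM x)].
rewrite !ler_norml => /andP[? ?] /andP[? ?].
by apply/andP; split; lra.
Qed.

(** If all differences of elements of [W] lie in [N], so does the closure of [W]; it remains to
    intersect this closure with a compact closed neighbourhood. *)
Lemma compact_nbhs : hausdorff_space G -> locally_compact [set: G] ->
  forall N, nbhs (0 : G) N -> exists2 V, [/\ compact V, closed V & V `<=` N] & nbhs (0 : G) V.
Proof.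
move=> hG lG N N0.
have [U U0' [cU clU]] := lG 0 I.
have U0 : nbhs (0 : G) U.
  by move: U0'; rewrite withinE => -[B B0 /seteqP[_ UB]]; apply: filterS B0 => x Bx; case: (UB x).
have [W W0 WN] := nbhs0_sub N0.
have cWN : closure W `<=` N.
  move=> x /(_ [set y | W (y - x)])[|y [Wy Wyx]]; first exact: nbhs_translate.
  by have := WN _ _ Wyx Wy; rewrite opprB addrC subrK.
exists (U `&` closure W).
  split.
  - apply: (subclosed_compact _ cU); last by move=> x [].
    by apply: closedI => //; exact: closed_closure.
  - by apply: closedI => //; exact: closed_closure.
  - by move=> x [_ /cWN].
by apply: filterI => //; apply: filterS W0; exact: subset_closure.
Qed.

(* [borelT G] carries no topology, hence the retyping. *)
Lemma open_borel U : open U -> measurable (U : set (borelT G)).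
Proof. by move=> oU; exact: sub_sigma_algebra. Qed.

Lemma closed_borel U : closed U -> measurable (U : set (borelT G)).
Proof.
by move=> /closed_openC/open_borel/measurableC; rewrite setCK.
Qed.

Lemma continuous_borel f : continuous f -> measurable_fun [set: borelT G] (f : borelT G -> R).
Proof.
move=> /continuousP cf; apply: (measurability _ (RGenOpens.measurableE R)).
move=> _ [_ [a [b ->] <-]]; rewrite setTI; apply: open_borel.
exact/cf/interval_open.
Qed.

Lemma translation_borel (a : G) :
  measurable_fun [set: borelT G] ((fun y => a + y) : borelT G -> borelT G).
Proof.
apply: (@measurability _ _ (borelT G) (borelT G) setT _
  (@open G : set (set (pointedZ G)))) => //.
move=> _ [U oU <-]; rewrite setTI; apply: open_borel.
by have /continuousP := @translation_continuous a; exact.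
Qed.

End topological_group.

(** * Haar measure and squared L2 norms *)

Section haar.
Context {R : realType} {G : topologicalZmodType}.
Variable mu : {measure set (borelT G) -> \bar R}.
Hypothesis hG : hausdorff_space G.
Hypothesis hmu : haar_measure mu.
Implicit Types (f g k : G -> R) (N U V : set G).

Lemma haar_preimage (a : G) (A : set (borelT G)) : measurable A ->
  mu ((fun y : G => a + y) @^-1` A) = mu A.
Proof.
move=> mA; have [inv _ _ _ _] := hmu.
rewrite -(inv (- a) A mA); congr (mu _); apply/seteqP; split=> y /=.
  by move=> Aay; exists (a + y) => //; rewrite addKr.
by move=> [z Az <-]; rewrite addNKr.
Qed.

Lemma ge0_haar_translation (a : G) (g : borelT G -> \bar R) :
  measurable_fun setT g -> (forall x, 0 <= g x)%E ->
  (\int[mu]_x g ((a + x)%R : G) = \int[mu]_x g x)%E.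
Proof.
move=> mg g0.
have /= := ge0_integral_pushforward (translation_borel a) mu measurableT mg (fun y _ => g0 y).
rewrite preimage_setT => <-; apply: eq_measure_integral; first exact: translation_borel.
by move=> ? A mA _; apply: haar_preimage.
Qed.

(** If [U] were null, every compact set would be null, being covered by finitely many translates of
    [U]. Inner regularity would then make the whole group null. *)
Lemma haar_open_gt0 U : open U -> U !=set0 -> (0 < mu U)%E.
Proof.
move=> oU [u Uu]; have [_ _ _ inner [A [mA A0]]] := hmu.
rewrite lt0e measure_ge0 andbT; apply/negP => /eqP U0.
have T0 : mu setT = 0%E.
  rewrite inner; last exact: openT.
  apply/eqP; rewrite eq_le; apply/andP; split; last first.
    by apply: ereal_sup_ubound; exists set0; [split; [exact: compact0|]|exact: measure0].
  apply: ge_ereal_sup => _ [K [cK _] <-].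
  pose f (x : G) := (fun y : G => (u - x) + y) @^-1` U.
  have of_ x : open (f x).
    by have /continuousP := @translation_continuous G (u - x); exact.
  have [|s _ Ks] := @compact_finite_cover G K f cK.
    by move=> x _; apply: open_nbhs_nbhs; split=> //; rewrite /f /= subrK.
  have fs t : measurable (\big[setU/set0]_(i <- t) f i : set (borelT G)) /\
      mu (\big[setU/set0]_(i <- t) f i) = 0%E.
    elim: t => [|x t [mt t0]]; first by rewrite big_nil; split=> //; exact: measure0.
    have mf : measurable (f x : set (borelT G)) by exact: open_borel.
    rewrite big_cons; split; first exact: measurableU.
    rewrite measureU0// -[RHS]U0; apply: haar_preimage; exact: open_borel.
  have [ms <-] := fs s.
  apply: le_measure; rewrite ?inE//; first by apply: closed_borel; exact: compact_closed.
  by move=> y /Ks[x xs fxy]; rewrite -bigcup_seq; exists x.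
move: A0; rewrite ltNge => /negP; apply; rewrite -T0.
by apply: le_measure; rewrite ?inE//; exact: measurableT.
Qed.

Lemma haar_nbhs_gt0 V : measurable (V : set (borelT G)) -> nbhs (0 : G) V -> (0 < mu V)%E.
Proof.
rewrite nbhsE => mV [U [oU U0] UV].
apply: (@lt_le_trans _ _ (mu U)); first by apply: haar_open_gt0 => //; exists 0.
by apply: le_measure; rewrite ?inE//; exact: open_borel.
Qed.

(** The squared L2 norm, kept in the extended reals so that it makes sense before square
    integrability is known. *)
Definition sqint g : \bar R := (\int[mu]_x ((g x) ^+ 2)%:E)%E.

Local Notation mfun g := (measurable_fun [set: borelT G] (g : borelT G -> R)).

Lemma measurable_sq g : mfun g ->
  measurable_fun [set: borelT G] (fun x : borelT G => ((g x) ^+ 2)%:E).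
Proof. by move=> mg; apply/measurable_EFinP; exact: measurable_funX. Qed.

Lemma sqint_translation a g : mfun g -> sqint (fun x => g (a + x)) = sqint g.
Proof.
move=> mg; apply: (ge0_haar_translation a (measurable_sq mg)) => x.
by rewrite lee_fin sqr_ge0.
Qed.

Lemma sqint_parallelogram f g : mfun f -> mfun g ->
  (sqint (fun x => f x - g x)%R + 4%:E * sqint (fun x => (f x + g x) / 2)%R =
  2%:E * sqint f + 2%:E * sqint g)%E.
Proof.
move=> mf mg.
have mB : mfun (fun x => f x - g x) by exact: measurable_funB.
have mD : mfun (fun x => (f x + g x) / 2).
  by apply: measurable_funM => //; exact: measurable_funD.
rewrite /sqint -!ge0_integralZl_EFin//; try exact: measurable_sq;
  try by move=> x _; rewrite lee_fin sqr_ge0.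
rewrite -!ge0_integralD//; try (apply: measurable_funeM; exact: measurable_sq);
  try exact: measurable_sq;
  try by move=> x _; rewrite ?mule_ge0// lee_fin sqr_ge0.
apply: eq_integral => x _; rewrite -!EFinM -!EFinD; congr EFin.
by field.
Qed.

(** The pointwise bound [(f + g)^2 <= 2 f^2 + 2 g^2] takes the place of Minkowski's inequality, at
    the price of a factor 2. *)
Lemma sqintD f g (a b : R) : mfun f -> mfun g ->
  (sqint f <= a%:E)%E -> (sqint g <= b%:E)%E ->
  (sqint (fun x => f x + g x)%R <= (2 * (a + b))%:E)%E.
Proof.
move=> mf mg fa gb.
apply: (@le_trans _ _ (2%:E * sqint f + 2%:E * sqint g)%E); last first.
  by rewrite mulrDr (EFinD (2 * a)); apply: leeD; rewrite EFinM lee_wpmul2l.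
rewrite /sqint -!ge0_integralZl_EFin//; try exact: measurable_sq;
  try by move=> x _; rewrite lee_fin sqr_ge0.
rewrite -ge0_integralD//; try (apply: measurable_funeM; exact: measurable_sq);
  try by move=> x _; rewrite ?mule_ge0// lee_fin sqr_ge0.
apply: ge0_le_integral => //.
- by move=> x _; rewrite lee_fin sqr_ge0.
- by apply: measurable_sq; exact: measurable_funD.
- by apply: emeasurable_funD; apply: measurable_funeM; exact: measurable_sq.
- move=> x _; rewrite -!EFinM -!EFinD lee_fin.
  by have := sqr_ge0 (f x - g x); lra.
Qed.

(** Jensen's inequality for the square, that is, nonnegativity of the variance at each point,
    followed by integration of a finite sum. *)
Lemma sqint_avg_le V P (h : G -> G -> R) (e : R) : prob_on V P ->
  (forall s, mfun (h s)) ->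
  (forall s, V s -> (sqint (h s) <= e%:E)%E) ->
  (sqint (fun x => avg P (fun s => h s x)) <= e%:E)%E.
Proof.
move=> PV mh he.
have p0 (i : 'I_(size P)) : 0 <= (tnth (in_tuple P) i).1.
  by case: (PV.1 _ (mem_tnth i (in_tuple P))).
pose H (i : 'I_(size P)) x :=
  ((tnth (in_tuple P) i).1%:E * ((h (tnth (in_tuple P) i).2 x) ^+ 2)%:E)%E.
have mH i : measurable_fun [set: borelT G] (H i).
  by apply: measurable_funeM; exact: measurable_sq.
have H0 i x : (0 <= H i x)%E by rewrite mule_ge0// lee_fin ?sqr_ge0.
apply: (@le_trans _ _ (\int[mu]_x \sum_(i < size P) H i x)%E).
  apply: ge0_le_integral => //.
  - by move=> x _; rewrite lee_fin sqr_ge0.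
  - by apply: measurable_sq; apply: measurable_sum => z; apply: measurable_funM.
  - by apply: emeasurable_sum.
  - move=> x _; under eq_bigr do rewrite /H -EFinM.
    rewrite sumEFin lee_fin -(avgE P (fun s => (h s x) ^+ 2)).
    set m := avg P _; rewrite -subr_ge0.
    suff <- : avg P (fun s => (h s x - m) ^+ 2) = avg P (fun s => (h s x) ^+ 2) - m ^+ 2.
      rewrite -(avg_cst 0 PV); apply: (le_avg PV) => s _; exact: sqr_ge0.
    have -> : (fun s => (h s x - m) ^+ 2) = (fun s => (h s x) ^+ 2 - (2 * m * h s x - m ^+ 2)).
      by apply/funext => s; ring.
    by rewrite !avgB avgZ (avg_cst _ PV) -/m; ring.
rewrite ge0_integral_sum//.
apply: (@le_trans _ _ (\sum_(i < size P) ((tnth (in_tuple P) i).1 * e)%:E)%E).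
  apply: lee_sum => i _; rewrite /H ge0_integralZl_EFin//; last 2 first.
  - by move=> x _; rewrite lee_fin sqr_ge0.
  - exact: measurable_sq.
  rewrite EFinM lee_wpmul2l ?lee_fin//.
  by apply: he; case: (PV.1 _ (mem_tnth i (in_tuple P))).
by rewrite sumEFin -(avgE P (fun=> e)) (avg_cst _ PV).
Qed.

End haar.

(** * Averages over a compact neighbourhood of 0 *)

Definition bounded_cont (R : realType) (G : topologicalType) (k : G -> R) : Prop :=
  continuous k /\ exists C, forall x, `|k x| <= C.

Definition mean (R : realType) (G : topologicalZmodType)
    (mu : {measure set (borelT G) -> \bar R}) (V : set G) (k : G -> R) : R :=
  (fine (mu V))^-1 * \int[mu]_(x in V) k x.

Section bounded_cont.
Context {R : realType} {G : topologicalZmodType}.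
Implicit Types (f g k : G -> R).

Lemma bounded_contB f g : bounded_cont f -> bounded_cont g ->
  bounded_cont (fun x => f x - g x).
Proof.
move=> [cf [C fC]] [cg [D gD]]; split; first by move=> x; apply: cvgB; [exact: cf|exact: cg].
by exists (C + D) => x; rewrite (le_trans (ler_normB _ _))// lerD.
Qed.

Lemma bounded_cont_shift f (x : G) : bounded_cont f -> bounded_cont (fun t => f (x + t)).
Proof.
move=> [cf [C fC]]; split; last by exists C.
by move=> t; apply: (@continuous_comp _ _ _ (fun t => x + t) f);
  [exact: translation_continuous|exact: cf].
Qed.

Lemma bounded_cont_flip f (x : G) : bounded_cont f -> bounded_cont (fun t => f (x - t)).
Proof.
move=> /(bounded_cont_shift x)[cf [C fC]]; split; last by exists C.
by move=> t; apply: (@continuous_comp _ _ _ (@GRing.opp G) (fun t => f (x + t)));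
  [exact: opp_continuous|exact: cf].
Qed.

Lemma bounded_cont_avg (P : seq (R * G)) (k : G -> G -> R) :
  (forall t, bounded_cont (k t)) -> bounded_cont (fun s => avg P (fun t => k t s)).
Proof.
move=> kb; rewrite /avg; elim: P => [|z P [cP [C PC]]].
  split; first by move=> x; rewrite [X in continuous_at _ X](_ : _ = cst 0);
    [exact: cvg_cst|apply/funext => s; rewrite big_nil].
  by exists 0 => x; rewrite big_nil normr0.
have [ck [D kD]] := kb z.2; split.
  move=> x; rewrite [X in continuous_at _ X](_ : _ =
    fun s => z.1 * k z.2 s + \sum_(y <- P) y.1 * k y.2 s); last first.
    by apply/funext => s; rewrite big_cons.
  by apply: cvgD; [apply: cvgMr; exact: ck|exact: cP].
exists (`|z.1| * D + C) => x; rewrite big_cons (le_trans (ler_normD _ _))// lerD//.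
by rewrite normrM ler_wpM2l.
Qed.

End bounded_cont.

(** The real arithmetic of carrying an error bound from finite averages [s'], [t'] over to the means
    [s], [t] that they approximate. *)
Lemma dist_drop_approx (R : realFieldType) (a b s t s' t' e : R) :
  `|s - s'| <= e / 2 -> `|t - t'| <= e / 2 -> `|a - s'| <= b - t' ->
  `|a - s| <= b - t + e.
Proof.
rewrite !ler_norml => /andP[? ?] /andP[? ?] /andP[? ?].
by apply/andP; split; lra.
Qed.

Section mean.
Context {R : realType} {G : topologicalZmodType}.
Variable mu : {measure set (borelT G) -> \bar R}.
Hypothesis hG : hausdorff_space G.
Hypothesis hmu : haar_measure mu.
Variable V : set G.
Hypothesis cV : compact V.
Hypothesis V0 : nbhs (0 : G) V.
Implicit Types (f g k : G -> R) (N U : set G) (P : seq (R * G)).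

Let mV : measurable (V : set (borelT G)).
Proof. by apply: closed_borel; exact: compact_closed. Qed.

Let muV_lty : (mu V < +oo)%E.
Proof. by have [_ + _ _ _] := hmu; exact. Qed.

Let m := fine (mu V).

Let m_gt0 : 0 < m.
Proof. by rewrite fine_gt0// muV_lty andbT; apply: haar_nbhs_gt0. Qed.

Let muVE : mu V = m%:E.
Proof. by rewrite fineK// ge0_fin_numE. Qed.

Lemma bounded_cont_integrable (B : set (borelT G)) k : bounded_cont k ->
  measurable B -> B `<=` V -> mu.-integrable B (EFin \o (k : borelT G -> R)).
Proof.
move=> [ck [C kC]] mB BV; apply: measurable_bounded_integrable => //.
- by apply: le_lt_trans muV_lty; apply: le_measure; rewrite ?inE.
- by apply: measurable_funTS; exact: continuous_borel.
- exists C; split; first exact: num_real.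
  by move=> D CD x _ /=; rewrite (le_trans (kC x))// ltW.
Qed.

Let integrableV k : bounded_cont k -> mu.-integrable V (EFin \o (k : borelT G -> R)).
Proof. by move=> kb; exact: bounded_cont_integrable. Qed.

Lemma meanB f g : bounded_cont f -> bounded_cont g ->
  mean mu V (fun x => f x - g x) = mean mu V f - mean mu V g.
Proof. by move=> fb gb; rewrite /mean RintegralB ?mulrBr//; exact: integrableV. Qed.

Lemma mean_avg P (k : G -> G -> R) : (forall t, bounded_cont (k t)) ->
  mean mu V (fun s => avg P (fun t => k t s)) = avg P (fun t => mean mu V (k t)).
Proof.
move=> kb; rewrite /avg; elim: P => [|z P IH].
  rewrite big_nil /mean; under eq_Rintegral do rewrite big_nil.
  by rewrite Rintegral_cst// mul0r mulr0.
rewrite big_cons -IH /mean; under eq_Rintegral do rewrite big_cons.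
rewrite RintegralD//; last 2 first.
- by have /integrableV := bounded_cont_avg [:: z] kb; under eq_fun do
    rewrite /avg /= big_cons big_nil addr0.
- exact/integrableV/(bounded_cont_avg P kb).
by rewrite RintegralZl ?mulrDr; [rewrite mulrCA|exact: mV|exact: integrableV].
Qed.

Lemma mean_norm_le k e : bounded_cont k -> (forall x, V x -> `|k x| <= e) ->
  `|mean mu V k| <= e.
Proof.
move=> kb ke; have mi : 0 <= m^-1 by rewrite invr_ge0 ltW.
rewrite /mean -/m normrM (ger0_norm mi) ler_pdivrMl//.
apply: le_trans (le_normr_Rintegral mV (integrableV kb)) _.
rewrite mulrC -(Rintegral_cst mu mV e); apply: le_Rintegral => //.
- exact: integrable_norm (integrableV kb).
- apply: integrableV; split; first by move=> x; exact: cvg_cst.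
  by exists `|e|.
Qed.

(* The weights are the measures of a partition of [V] into small pieces, so they
   serve all functions [k] with the same modulus of continuity at once. *)
Lemma mean_approx N : nbhs (0 : G) N -> exists2 P, prob_on V P &
  forall k e, bounded_cont k -> (forall s t, N (s - t) -> `|k s - k t| <= e) ->
  `|mean mu V k - avg P k| <= e.
Proof.
(* Interiors are taken so that the pieces cut out of [V] are Borel sets. *)
move=> N0; pose f (i : G) := [set y : G | N (y - i)]^°.
have of_ i : open (f i) by exact: open_interior.
have [|s sV Vs] := @compact_finite_cover G V f cV.
  by move=> i _; apply: open_nbhs_nbhs; split=> //; exact: nbhs_translate.
suff [P [PV P1 PN]] : exists P : seq (R * G), [/\ forall z, z \in P -> 0 <= z.1 /\ V z.2,
   avg P (fun=> 1) = m & forall k e, bounded_cont k ->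
     (forall s t, N (s - t) -> `|k s - k t| <= e) ->
     `|\int[mu]_(x in V) k x - avg P k| <= e * m].
  have scaleE k : avg [seq (m^-1 * z.1, z.2) | z <- P] k = m^-1 * avg P k.
    by rewrite /avg big_map mulr_sumr; apply: eq_bigr => z _; rewrite mulrA.
  exists [seq (m^-1 * z.1, z.2) | z <- P].
    split; last by rewrite scaleE P1 mulVf// gt_eqF.
    by move=> _ /mapP[z /PV[z0 Vz] ->]; split=> //=; rewrite mulr_ge0// invr_ge0 ltW.
  move=> k e kb ke; have mi : 0 <= m^-1 by rewrite invr_ge0 ltW.
  rewrite scaleE /mean -/m -mulrBr normrM (ger0_norm mi) ler_pdivrMl// mulrC.
  exact: PN.
(* Induction on the list of centres, for an arbitrary Borel part [B] of [V]: the piece of [B] near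
   the first centre is split off and the rest is covered by the remaining centres. *)
suff H (t : seq G) (B : set (borelT G)) : {in t, forall x, x \in V} -> measurable B -> B `<=` V ->
    (forall y, B y -> exists2 x, x \in t & f x y) ->
   exists P : seq (R * G), [/\ forall z, z \in P -> 0 <= z.1 /\ V z.2,
   avg P (fun=> 1) = fine (mu B) & forall k e, bounded_cont k ->
     (forall s t, N (s - t) -> `|k s - k t| <= e) ->
     `|\int[mu]_(x in B) k x - avg P k| <= e * fine (mu B)] by exact: (H s V sV mV (fun=> id) Vs).
elim: t B => [|i t IH] B tV mB BVV BV.
  exists [::]; have -> : B = set0 by rewrite -subset0 => y /BV[].
  split=> [//||k e kb ke]; first by rewrite measure0 /avg big_nil.
  by rewrite Rintegral_set0 /avg big_nil subrr normr0 measure0 mulr0.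
have iV : V i by apply/set_mem/tV; rewrite in_cons eqxx.
have mf : measurable (f i : set (borelT G)) by exact: open_borel.
have mB1 : measurable (B `&` f i : set (borelT G)) by exact: measurableI.
have mB2 : measurable (B `\` f i : set (borelT G)) by exact: measurableD.
have B1V : B `&` f i `<=` V by move=> y [/BVV].
have B2V : B `\` f i `<=` V by move=> y [/BVV].
have dB : [disjoint B `&` f i & B `\` f i].
  by apply/disj_set2P; rewrite -subset0 => y [[_ ?] [_]].
have BE : B = (B `&` f i) `|` (B `\` f i) by rewrite setUIDK.
have fin A : measurable (A : set (borelT G)) -> A `<=` V -> mu A \is a fin_num.
  move=> mA AV; rewrite ge0_fin_numE//; apply: le_lt_trans muV_lty.
  by apply: le_measure; rewrite ?inE.
have muB : fine (mu B) = fine (mu (B `&` f i)) + fine (mu (B `\` f i)).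
  rewrite -fineD; [|exact: fin|exact: fin].
  by rewrite {1}BE measureU//; apply/disj_set2P.
have [P [PV P1 PN]] : exists P : seq (R * G), [/\ forall z, z \in P -> 0 <= z.1 /\ V z.2,
   avg P (fun=> 1) = fine (mu (B `\` f i)) & forall k e, bounded_cont k ->
     (forall s t, N (s - t) -> `|k s - k t| <= e) ->
     `|\int[mu]_(x in B `\` f i) k x - avg P k| <= e * fine (mu (B `\` f i))].
  apply: IH => //.
    by move=> x xs; apply: tV; rewrite in_cons xs orbT.
  move=> y [By nfy]; have [x] := BV y By.
  by rewrite in_cons => /predU1P[-> //|xs fxy]; exists x.
(* The new atom is the centre [i], a point of [V] that need not belong to [B], weighted by the
   measure of the piece around it. *)
exists ((fine (mu (B `&` f i)), i) :: P); split.
- move=> z; rewrite in_cons => /predU1P[-> /=|]; last exact: PV.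
  by split=> //; exact: fine_ge0.
- by rewrite /avg big_cons /= mulr1 -/(avg P (fun=> 1)) P1 muB.
move=> k e kb ke; rewrite /avg big_cons /= -/(avg P k) muB mulrDr.
rewrite {1}BE Rintegral_setU//; last by rewrite -BE; exact: bounded_cont_integrable.
rewrite opprD addrACA (le_trans (ler_normD _ _))// lerD//; last exact: PN.
have ib : mu.-integrable (B `&` f i) (EFin \o (fun x : borelT G => k x - k i)).
  apply: bounded_cont_integrable => //; apply: bounded_contB => //.
  by split; [move=> x; exact: cvg_cst|exists `|k i|].
rewrite [X in _ - X]mulrC -(Rintegral_cst mu mB1 (k i)) -RintegralB//; last 2 first.
- exact: bounded_cont_integrable.
- by apply: bounded_cont_integrable => //; split; [move=> x; exact: cvg_cst|exists `|k i|].
apply: le_trans (le_normr_Rintegral mB1 ib) _.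
rewrite -(Rintegral_cst mu mB1 e); apply: le_Rintegral => //.
- exact: integrable_norm ib.
- by apply: bounded_cont_integrable => //; split; [move=> x; exact: cvg_cst|exists `|e|].
- by move=> x [_ fix_]; apply: ke; exact: (interior_subset fix_).
Qed.

(** A form of Cauchy-Schwarz, obtained from [|k| <= e / 2 + k^2 / (2 e)]: with [d = e^2 m] the
    integral over [V] is at most [e m / 2 + e m / 2]. Translation invariance makes [d] independent
    of [x]. *)
Lemma mean_sqint_le (e : R) : 0 < e -> exists2 d, 0 < d & forall g, bounded_cont g ->
  (sqint mu g <= d%:E)%E -> forall x, `|mean mu V (fun t => g (x + t))| <= e.
Proof.
move=> e0; exists (e ^+ 2 * m); first by rewrite mulr_gt0// exprn_gt0.
move=> g gb gd x; have kb := bounded_cont_shift x gb.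
have mk := continuous_borel kb.1.
move: gd; rewrite -(sqint_translation hmu x (continuous_borel gb.1)).
move: kb mk; set k := (fun t => g (x + t)) => kb mk kd.
have mi : 0 <= m^-1 by rewrite invr_ge0 ltW.
rewrite /mean -/m normrM (ger0_norm mi) ler_pdivrMl//.
apply: le_trans (le_normr_Rintegral mV (integrableV kb)) _.
have ik := integrable_norm (integrableV kb).
rewrite -lee_fin /Rintegral fineK; last exact: integrable_fin_num ik.
have mk2 : measurable_fun (V : set (borelT G))
    (fun t : borelT G => ((2 * e)^-1%:E * ((k t) ^+ 2)%:E)%E).
  by apply: measurable_funTS; apply: measurable_funeM; exact: measurable_sq.
apply: (@le_trans _ _ (\int[mu]_(t in V) ((e / 2)%:E + (2 * e)^-1%:E * ((k t) ^+ 2)%:E))%E).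
  apply: ge0_le_integral => //.
  - by have /integrableP[] := ik.
  - by apply: emeasurable_funD.
  - move=> t _; rewrite -EFinM -EFinD lee_fin -(ler_pM2l (_ : 0 < 2 * e)) ?mulr_gt0//.
    rewrite mulrDr mulVKf ?gt_eqF ?mulr_gt0//.
    have -> : 2 * e * (e / 2) = e ^+ 2 by field.
    by rewrite -[(k t) ^+ 2]real_normK ?num_real//; have := sqr_ge0 (e - `|k t|); lra.
rewrite ge0_integralD//; last 2 first.
- by move=> t _; rewrite lee_fin divr_ge0// ltW.
- by move=> t _; rewrite -EFinM lee_fin mulr_ge0 ?sqr_ge0// invr_ge0 mulr_ge0// ltW.
rewrite integral_cst// muVE.
rewrite ge0_integralZl_EFin//; last 3 first.
- by move=> t _; rewrite lee_fin sqr_ge0.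
- by apply: measurable_funTS; exact: measurable_sq.
- by rewrite invr_ge0 mulr_ge0// ltW.
apply: (@le_trans _ _ ((e / 2)%:E * m%:E + (2 * e)^-1%:E * (e ^+ 2 * m)%:E)%E).
  apply: leeD2l; apply: lee_wpmul2l; first by rewrite lee_fin invr_ge0 mulr_ge0// ltW.
  apply: le_trans kd; apply: ge0_subset_integral => //; first exact: measurable_sq.
  by move=> t _; rewrite lee_fin sqr_ge0.
rewrite -!EFinM -EFinD lee_fin le_eqVlt; apply/orP; left; apply/eqP.
by field; rewrite gt_eqF.
Qed.

Lemma mean_shift_unif_cont f : bounded_cont f -> unif_cont f ->
  unif_cont (fun x => mean mu V (fun t => f (x + t))).
Proof.
move=> fb uf e /uf[N N0 fN]; exists N => // x u Nu.
rewrite -meanB; [|exact: bounded_cont_shift|exact: bounded_cont_shift].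
apply: mean_norm_le => [|t _]; first by apply: bounded_contB; exact: bounded_cont_shift.
by rewrite addrAC; exact: fN.
Qed.

Lemma mean_shift_bounded_cont f : bounded_cont f -> unif_cont f ->
  bounded_cont (fun x => mean mu V (fun t => f (x + t))).
Proof.
move=> fb uf; split; first exact/unif_cont_continuous/mean_shift_unif_cont.
have [_ [C fC]] := fb; exists C => x; apply: mean_norm_le => //.
exact: bounded_cont_shift.
Qed.

Lemma smooth_mean_inner f x : bounded_cont f -> unif_cont f ->
  bounded_cont (fun s => mean mu V (fun t => f (x - s + t))).
Proof. by move=> fb uf; apply: bounded_cont_flip (mean_shift_bounded_cont fb uf). Qed.

Lemma smooth_meanB f g x : bounded_cont f -> unif_cont f -> bounded_cont g -> unif_cont g ->
  smooth (mean mu V) (fun y => f y - g y) x =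
  smooth (mean mu V) f x - smooth (mean mu V) g x.
Proof.
move=> fb uf gb ug; rewrite /smooth -meanB; [|exact: smooth_mean_inner|exact: smooth_mean_inner].
congr (mean _ _ _); apply/funext => s; rewrite meanB//; exact: bounded_cont_shift.
Qed.

Lemma smooth_mean_sqint_le e : 0 < e -> exists2 d, 0 < d & forall g,
  bounded_cont g -> unif_cont g -> (sqint mu g <= d%:E)%E ->
  forall x, `|smooth (mean mu V) g x| <= e.
Proof.
move=> /mean_sqint_le[d d0 gd]; exists d => // g gb ug /(gd _ gb) ge x.
by apply: mean_norm_le => [|s _]; [exact: smooth_mean_inner|exact: ge].
Qed.

(** The two smoothings commute because a finite average passes through an integral by linearity
    alone. *)
Lemma smooth_mean_avg P f x : bounded_cont f -> unif_cont f ->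
  smooth (mean mu V) (smooth (avg P) f) x = smooth (avg P) (smooth (mean mu V) f) x.
Proof.
move=> fb uf; rewrite /smooth.
have swap y : mean mu V (fun t => avg P (fun a => avg P (fun b => f (y + t - a + b)))) =
    avg P (fun a => avg P (fun b => mean mu V (fun t => f (y - a + b + t)))).
  have E a b : (fun t => f (y + t - a + b)) = (fun t => f (y - a + b + t)).
    by apply/funext => t; rewrite (addrAC y) [y - a + t + b]addrAC.
  rewrite mean_avg => [|a]; last first.
    by apply: bounded_cont_avg => b; rewrite E; exact: bounded_cont_shift.
  apply: eq_avg => a; rewrite mean_avg => [|b]; last by rewrite E; exact: bounded_cont_shift.
  by apply: eq_avg => b; rewrite E.
under eq_fun do rewrite swap.
have E a b : (fun s => mean mu V (fun t => f (x - s - a + b + t))) =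
    (fun s => mean mu V (fun t => f (x - a + b - s + t))).
  by apply/funext => s; rewrite (addrAC x) [x - a - s + b]addrAC.
rewrite mean_avg => [|a]; last first.
  by apply: bounded_cont_avg => b; rewrite E; exact: smooth_mean_inner.
apply: eq_avg => a; rewrite mean_avg => [|b]; last by rewrite E; exact: smooth_mean_inner.
by apply: eq_avg => b; rewrite E.
Qed.

Lemma smooth_mean_approx f e : bounded_cont f -> unif_cont f -> 0 < e ->
  exists2 P, prob_on V P & forall x, `|smooth (mean mu V) f x - smooth (avg P) f x| <= e.
Proof.
move=> fb uf e0; have e2 : 0 < e / 2 by rewrite divr_gt0.
have [N N0 fN] := uf _ e2.
(* A symmetric neighbourhood is used because the same list approximates the inner mean, in [y + t],
   and the outer one, in [x - s], where increments change sign. *)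
have [P PV Pk] := mean_approx (filterI N0 (nbhs0_opp N0)).
have near1 y : `|mean mu V (fun t => f (y + t)) - avg P (fun t => f (y + t))| <= e / 2.
  apply: Pk => [|s t [Nst _]]; first exact: bounded_cont_shift.
  by have := fN (y + t) _ Nst; rewrite -addrA [t + _]addrC subrK.
pose A y := mean mu V (fun t => f (y + t)).
have AN y u : N u -> `|A (y + u) - A y| <= e / 2.
  move=> Nu; rewrite /A -meanB; [|exact: bounded_cont_shift|exact: bounded_cont_shift].
  apply: mean_norm_le => [|t _]; first by apply: bounded_contB; exact: bounded_cont_shift.
  by rewrite addrAC; exact: fN.
exists P => // x; rewrite (splitr e).
have -> : smooth (mean mu V) f x - smooth (avg P) f x =
    (smooth (mean mu V) f x - avg P (fun s => A (x - s))) +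
    (avg P (fun s => A (x - s)) - smooth (avg P) f x) by ring.
apply: le_trans (ler_normD _ _) _; apply: lerD.
  apply: Pk => [|s t [_ Nst]]; first exact: smooth_mean_inner.
  by have := AN (x - t) _ Nst; rewrite opprB addrA subrK.
rewrite /smooth -avgB; apply: (norm_avg_le PV) => s _; exact: near1.
Qed.

(** The inequality for finite averages passes to the limit, since the approximation is uniform and
    thus valid at [x] and at [0] for the same list. *)
Lemma pd_sub_smooth_mean f x : bounded_cont f -> unif_cont f -> real_pd f ->
  `|f x - smooth (mean mu V) f x| <= f 0 - smooth (mean mu V) f 0.
Proof.
move=> fb uf pf; apply/ler_addgt0Pr => e e0; have e2 : 0 < e / 2 by rewrite divr_gt0.
have [P PV fP] := smooth_mean_approx fb uf e2.
exact: dist_drop_approx (fP x) (fP 0) (pd_sub_smooth x PV pf).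
Qed.

End mean.

(** * Smoothing a sequence that is Cauchy in L2 *)

Section uniform_limit.
Context {R : realType} {T : Type}.

Lemma almost_increasing_cauchy (u : nat -> T -> R) (x0 : T) :
  (forall k, u k x0 <= 1) ->
  (forall k l x, (k < l)%N -> `|u l x - u k x| <= u l x0 - u k x0 + 2^-1 ^+ k) ->
  forall e : R, 0 < e -> exists K, forall k l x, (K <= k)%N -> (K <= l)%N ->
    `|u k x - u l x| <= e.
Proof.
(* Since [u k x0 - u j x0 + 2^-j = b k - b j + 2^-k], an index [j] with [b j] within [e / 4] of the
   supremum bounds all late increments from [j] by [e / 2]. *)
move=> u1 uinc e e0; pose b k := u k x0 - 2^-1 ^+ k.
have p0 k : 0 < 2^-1 ^+ k :> R by rewrite exprn_gt0// invr_gt0.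
have bsup : has_sup (range b).
  split; first by exists (b 0%N); exists 0%N.
  by exists 1 => _ [k _ <-]; rewrite /b lerBlDr (le_trans (u1 k))// lerDl ltW.
have e4 : 0 < e / 4 by rewrite divr_gt0.
have [_ [j _ <-] bj] := sup_adherent e4 bsup.
have : (fun n => 2^-1 ^+ n : R) @ \oo --> (0 : R).
  by apply: cvg_expr; rewrite ger0_norm ?invr_ge0// invf_lt1// ltr1n.
move=> /cvgrPdist_le /(_ _ e4)[N _ Nsmall].
(* The successor of [j] appears because the hypothesis compares strictly ordered indices. *)
exists (maxn j.+1 N).
suff H k x : (maxn j.+1 N <= k)%N -> `|u k x - u j x| <= e / 2.
  move=> k l x /(H _ x) + /(H _ x); rewrite !ler_norml => /andP[? ?] /andP[? ?].
  by apply/andP; split; lra.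
rewrite geq_max => /andP[jk Nk]; apply: le_trans (uinc _ _ x jk) _.
have bk : b k <= sup (range b) by apply: ub_le_sup; [exact: bsup.2|exists k].
have := Nsmall k Nk; rewrite /= sub0r normrN (ger0_norm (ltW (p0 k))).
move: bj bk; rewrite /b; lra.
Qed.

Lemma uniform_cauchy_limit (u : nat -> T -> R) :
  (forall e : R, 0 < e -> exists K, forall k l x, (K <= k)%N -> (K <= l)%N ->
    `|u k x - u l x| <= e) ->
  exists phi : T -> R, forall e : R, 0 < e -> exists K, forall k x, (K <= k)%N ->
    `|phi x - u k x| <= e.
Proof.
move=> ucauchy.
have ucvg x : cvgn (u ^~ x).
  apply: cauchy_cvg; apply/cauchy_exP => e e0.
  have e2 : 0 < e / 2 by rewrite divr_gt0.
  have [K uK] := ucauchy _ e2.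
  exists (u K x); exists K => // k /= Kk; rewrite /ball /=.
  by apply: le_lt_trans (uK K k x _ Kk) _ => //; rewrite ltr_pdivrMr// ltr_pMr// ltr1n.
exists (fun x => limn (u ^~ x)) => e e0; have [K uK] := ucauchy _ e0.
exists K => k x Kk; apply/ler_addgt0Pr => d d0.
have /cvgrPdist_le/(_ _ d0)[N _ Nd] := ucvg x.
have := Nd (maxn N K) (leq_maxl _ _); have := uK (maxn N K) k x (leq_maxr _ _) Kk.
rewrite /= !ler_norml => /andP[? ?] /andP[? ?].
by apply/andP; split; lra.
Qed.

End uniform_limit.

Lemma dist_trans_drop (R : realFieldType) (a b c s t c0 e : R) : 0 < e ->
  `|a - s| <= b - t -> `|s - c| <= 3 * e / 8 -> `|t - c0| <= 3 * e / 8 ->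
  `|a - c| <= b - c0 + e.
Proof.
move=> e0; rewrite !ler_norml => /andP[? ?] /andP[? ?] /andP[? ?].
by apply/andP; split; lra.
Qed.

Section sqint_cauchy.
Context {R : realType} {G : topologicalZmodType}.
Variable mu : {measure set (borelT G) -> \bar R}.
Hypothesis hG : hausdorff_space G.
Hypothesis lG : locally_compact [set: G].
Hypothesis hmu : haar_measure mu.

(** In the square of [g (x + u) - g x] one factor is at most [d] by uniform continuity and the other
    at most [|g (x + u)| + |g x|], whose integral is twice that of [|g|]. *)
Lemma sqint_translation_near (g : G -> R) (e : R) : unif_cont g ->
  mu.-integrable setT (fun x : borelT G => (g x)%:E) -> 0 < e ->
  exists2 N, nbhs (0 : G) N & forall u, N u ->
    (sqint mu (fun x => g (x + u) - g x)%R <= e%:E)%E.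
Proof.
move=> ug /integrableP[mg gfin] e0.
have mgR : measurable_fun [set: borelT G] (g : borelT G -> R).
  by apply: continuous_borel; exact: unif_cont_continuous.
set I := (\int[mu]_x `|(g x)%:E|)%E in gfin.
have I0 : (0 <= I)%E by apply: integral_ge0 => x _; exact: abse_ge0.
have IE : I = (fine I)%:E by rewrite fineK// ge0_fin_numE.
have fI0 : 0 <= fine I by exact: fine_ge0.
pose d := e / (2 * fine I + 1).
have I1 : 0 < 2 * fine I + 1 by rewrite ltr_wpDl// mulr_ge0.
have d0 : 0 < d by rewrite divr_gt0.
have [N N0 gN] := ug _ d0; exists N => // u Nu.
have mgu : measurable_fun [set: borelT G] ((fun x => g (u + x)) : borelT G -> R).
  by apply: (measurableT_comp mgR); exact: translation_borel.
have -> : (fun x => g (x + u) - g x) = (fun x => g (u + x) - g x).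
  by apply/funext => x; rewrite (addrC x u).
apply: (@le_trans _ _ (\int[mu]_x (d%:E * (`|g (u + x)%R|%:E + `|g x|%:E)))%E).
  apply: ge0_le_integral => //.
  - by move=> x _; rewrite lee_fin sqr_ge0.
  - by apply: measurable_sq; exact: measurable_funB.
  - by apply: measurable_funeM; apply: emeasurable_funD;
      apply/measurable_EFinP; exact: measurableT_comp.
  - move=> x _; rewrite -EFinD -EFinM lee_fin -real_normK ?num_real// expr2.
    apply: ler_pM => //; first by rewrite (addrC u x); exact: gN.
    exact: ler_normB.
rewrite ge0_integralZl_EFin//; last 3 first.
- by move=> x _; rewrite adde_ge0// lee_fin.
- by apply: emeasurable_funD; apply/measurable_EFinP; exact: measurableT_comp.
- exact: ltW.
rewrite ge0_integralD//; last 2 first.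
- by apply/measurable_EFinP; exact: measurableT_comp.
- by apply/measurable_EFinP; exact: measurableT_comp.
rewrite (ge0_haar_translation hmu u (g := fun x : borelT G => `|g x|%:E))//; last first.
  by apply/measurable_EFinP; exact: measurableT_comp.
have -> : (\int[mu]_x `|g x|%:E)%E = I by [].
rewrite IE -EFinD -EFinM lee_fin /d mulrAC ler_pdivrMr// ler_pM2l//; lra.
Qed.

Variable f : nat -> G -> R.
Hypothesis f_pd : forall n, real_pd (f n).
Hypothesis f_uc : forall n, unif_cont (f n).
Hypothesis f_le1 : forall n, f n 0 <= 1.
Hypothesis f_int : forall n, mu.-integrable setT (fun x : borelT G => (f n x)%:E).
Hypothesis f_cauchy : forall e : R, 0 < e -> exists N, forall m n,
  (N <= m)%N -> (N <= n)%N -> (sqint mu (fun x => f m x - f n x)%R <= e%:E)%E.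

Let f_bc n : bounded_cont (f n).
Proof.
split; first exact: unif_cont_continuous.
by exists 1 => x; rewrite (le_trans (pd_norm_le x (f_pd n))).
Qed.

Let mf n : measurable_fun [set: borelT G] (f n : borelT G -> R).
Proof. exact: continuous_borel (f_bc n).1. Qed.

(** The error is the smoothing of [f m - f M], plus the smoothing error of [f M], plus [f M - f m].
    Only the middle term depends on [V], and [M] is fixed, so one [V] serves all [m] beyond [M]. *)
Lemma smooth_near_sqint (e : R) : 0 < e -> exists V M, nbhs (0 : G) V /\
  forall P m, prob_on V P -> (M <= m)%N ->
    (sqint mu (fun x => smooth (avg P) (f m) x - f m x)%R <= e%:E)%E.
Proof.
move=> e0; have d0 : 0 < e / 10 by rewrite divr_gt0.
have [M fM] := f_cauchy d0.
have [N N0 fN] := sqint_translation_near (f_uc M) (f_int M) d0.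
have [V V0 VN] := nbhs0_sub N0.
exists V, M; split=> // P m PV Mm.
have mshift g s t : measurable_fun [set: borelT G] (g : borelT G -> R) ->
    measurable_fun [set: borelT G] ((fun x => g (x - s + t)) : borelT G -> R).
  move=> mg; have -> : (fun x => g (x - s + t)) = (fun x => g (t - s + x)).
    by apply/funext => x; rewrite addrAC -addrA addrC -addrA.
  by apply: (measurableT_comp mg); exact: translation_borel.
have mavg (h : G -> G -> R) : (forall t, measurable_fun [set: borelT G] (h t : borelT G -> R)) ->
    measurable_fun [set: borelT G] ((fun x => avg P (fun t => h t x)) : borelT G -> R).
  by move=> mh; apply: measurable_sum => z; exact: measurable_funM.
pose g x := f m x - f M x.
have mg : measurable_fun [set: borelT G] (g : borelT G -> R) by exact: measurable_funB.
have -> : (fun x => smooth (avg P) (f m) x - f m x) = (fun x => smooth (avg P) g x +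
    (avg P (fun s => avg P (fun t => f M (x - s + t) - f M x)) + (f M x - f m x))).
  apply/funext => x.
  have -> : avg P (fun s => avg P (fun t => f M (x - s + t) - f M x)) =
     smooth (avg P) (f M) x - f M x.
    rewrite /smooth -[X in _ - X](avg_cst _ PV) -avgB; apply: eq_avg => s.
    by rewrite -[X in _ - X](avg_cst _ PV) -avgB.
  by rewrite /g avg_smoothB; ring.
(* Two nested uses of [sqintD] produce this combination. *)
have -> : e = 2 * (e / 10 + 2 * (e / 10 + e / 10)) by field.
apply: sqintD.
- by apply: (mavg) => s; apply: (mavg) => t; exact: mshift.
- apply: measurable_funD; last exact: measurable_funB.
  by apply: (mavg) => s; apply: (mavg) => t; apply: measurable_funB => //; exact: mshift.
- apply: (sqint_avg_le PV) => [s|s Vs]; first by apply: (mavg) => t; exact: mshift.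
  apply: (sqint_avg_le PV) => [t|t Vt]; first exact: mshift.
  have -> : (fun x => g (x - s + t)) = (fun x => g (t - s + x)).
    by apply/funext => x; rewrite addrAC -addrA addrC -addrA.
  by rewrite (sqint_translation hmu)//; exact: fM.
- apply: sqintD; last by apply: fM.
  + by apply: (mavg) => s; apply: (mavg) => t; apply: measurable_funB => //; exact: mshift.
  + exact: measurable_funB.
  + apply: (sqint_avg_le PV) => [s|s Vs].
      by apply: (mavg) => t; apply: measurable_funB => //; exact: mshift.
    apply: (sqint_avg_le PV) => [t|t Vt].
      by apply: measurable_funB => //; exact: mshift.
    have -> : (fun x => f M (x - s + t) - f M x) = (fun x => f M (x + (t - s)) - f M x).
      by apply/funext => x; rewrite addrAC addrA.
    by apply: fN; exact: VN.
Qed.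

(** Let [S] be smoothing by the mean over a compact [W] inside [V]. Then [S psi'] is the
    [P']-smoothing of [S (f m')], which is uniformly near [S (f m)] by L2 closeness and hence near
    [psi]. If [V'] is small, smoothing [psi] by [P'] hardly changes it, so [S psi'] is near [psi].
    Finally [psi' - S psi'] is dominated by its value at [0]. *)
Lemma smooth_almost_increasing (V : set G) M (e : R) : nbhs (0 : G) V -> 0 < e ->
  exists P m V' M', [/\ prob_on V P, (M <= m)%N, nbhs (0 : G) V' &
    forall P' m' x, prob_on V' P' -> (M' <= m')%N ->
      `|smooth (avg P') (f m') x - smooth (avg P) (f m) x| <=
      smooth (avg P') (f m') 0 - smooth (avg P) (f m) 0 + e].
Proof.
move=> V0 e0; have e8 : 0 < e / 8 by rewrite divr_gt0.
have [W [cW _ WV] W0] := compact_nbhs hG lG V0.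
have [d d0 dsmall] := smooth_mean_sqint_le hG hmu cW W0 e8.
have [N fN] := f_cauchy d0.
set m := maxn M N.
have [P PW fP] := smooth_mean_approx hG hmu cW W0 (f_bc m) (f_uc m) e8.
have [U U0 psiU] := unif_cont_smooth PW (f_uc m) e8.
have [V' V'0 V'U] := nbhs0_sub U0.
exists P, m, V', N; split=> //; [exact: prob_on_sub PW|exact: leq_maxl|].
move=> P' m' x PV' Nm'; set S := smooth (mean mu W).
set psi' := smooth (avg P') (f m'); set psi := smooth (avg P) (f m).
have close y : `|S (f m') y - psi y| <= e / 4.
  have := dsmall (fun x => f m' x - f m x) (bounded_contB (f_bc m') (f_bc m))
    (unif_contB (f_uc m') (f_uc m)) (fN _ _ Nm' (leq_maxr _ _)) y.
  rewrite (smooth_meanB hG hmu cW W0)// => le_S; apply: le_trans (ler_distD (S (f m) y) _ _) _.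
  have -> : e / 4 = e / 8 + e / 8 by field.
  by apply: lerD => //; exact: fP.
have Spsi' y : `|S psi' y - psi y| <= 3 * e / 8.
  rewrite /S /psi' (smooth_mean_avg hG hmu cW W0)// -/S.
  apply: le_trans (ler_distD (smooth (avg P') psi y) _ _) _.
  have -> : 3 * e / 8 = e / 4 + e / 8 by field.
  apply: lerD; first by have := avg_smooth_norm_le PV' close y; rewrite avg_smoothB.
  by apply: (avg_smooth_near PV') => s t Vs Vt; rewrite -addrA [- s + t]addrC; apply/psiU/V'U.
have psi'pd : real_pd psi' by exact: real_pd_smooth.
have psi'uc : unif_cont psi' by exact: unif_cont_smooth PV' _.
have psi'bc : bounded_cont psi'.
  split; first exact: unif_cont_continuous.
  by exists (psi' 0) => y; exact: pd_norm_le.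
exact: dist_trans_drop e0 (pd_sub_smooth_mean hG hmu cW W0 x psi'bc psi'uc psi'pd)
  (Spsi' x) (Spsi' 0).
Qed.

Lemma sqint_cauchy_limit : exists (phi : G -> R) (m : nat -> nat) (psi : nat -> G -> R),
  [/\ [/\ real_pd phi, unif_cont phi & phi 0 <= 1],
    forall k, (k <= m k)%N,
    forall k, continuous (psi k),
    forall e : R, 0 < e -> exists K, forall k x, (K <= k)%N -> `|phi x - psi k x| <= e &
    forall k, (sqint mu (fun x => psi k x - f (m k) x)%R <= (4^-1 ^+ k)%:E)%E].
Proof.
pose Out := (set G * nat * seq (R * G) * nat)%type.
(* One step of the recursion: a neighbourhood and a threshold index are refined, and an average and
   an index are output. The neighbourhood condition is a premise inside the existential, so that
   choice gives a total function. *)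
have step (z : nat * (set G * nat)) : exists o : Out,
    nbhs (0 : G) z.2.1 -> let: (k, (V, M)) := z in let: (V', M', P, m) := o in
    [/\ [/\ nbhs (0 : G) V', V' `<=` V & (M <= M')%N], [/\ prob_on V P, (M <= m)%N & (k <= m)%N],
     (sqint mu (fun x => smooth (avg P) (f m) x - f m x)%R <= (4^-1 ^+ k)%:E)%E &
     forall P' m' x, prob_on V' P' -> (M' <= m')%N ->
      `|smooth (avg P') (f m') x - smooth (avg P) (f m) x| <=
      smooth (avg P') (f m') 0 - smooth (avg P) (f m) 0 + 2^-1 ^+ k].
  case: z => k [V M] /=; have [V0|nV0] := pselect (nbhs (0 : G) V); last first.
    (* An arbitrary value, as the premise fails here. *)
    by exists (V, M, [::], k).
  have [|U [M0 [U0 UM0]]] := @smooth_near_sqint (4^-1 ^+ k).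
    by rewrite exprn_gt0// invr_gt0.
  (* Intersecting with [U] and raising the threshold to [M0] makes the same average also close to
     [f m] in L2. *)
  have [|P [m [V' [M' [PV mM V'0 H]]]]] :=
    @smooth_almost_increasing (V `&` U) (maxn k (maxn M M0)) (2^-1 ^+ k) (filterI V0 U0).
    by rewrite exprn_gt0// invr_gt0.
  move: mM; rewrite !geq_max => /and3P[km Mm M0m].
  exists (V' `&` V, maxn M M', P, m) => _; split.
  - by split; [exact: filterI|move=> x []|exact: leq_maxl].
  - by split=> //; apply: prob_on_sub PV => x [].
  - by apply: UM0 => //; apply: prob_on_sub PV => x [].
  - move=> P' m' x PV' M'm'; apply: H; first by apply: prob_on_sub PV' => y [].
    by apply: leq_trans M'm'; exact: leq_maxr.
have [F HF] := choice step.
pose st := nat_rect (fun=> (set G * nat)%type) ([set: G], 0%N)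
  (fun k s => (F (k, s)).1.1).
have stS k : st k.+1 = (F (k, st k)).1.1 by [].
have st0 k : nbhs (0 : G) (st k).1.
  elim: k => [|k IH]; first exact: filterT.
  have := HF (k, st k) IH; rewrite stS; case: (st k) => V M.
  by case: (F _) => -[[V' M'] P] m [[]].
pose P k := (F (k, st k)).1.2; pose m k := (F (k, st k)).2.
have spec k : [/\ [/\ (st k.+1).1 `<=` (st k).1 & ((st k).2 <= (st k.+1).2)%N],
     [/\ prob_on (st k).1 (P k), ((st k).2 <= m k)%N & (k <= m k)%N],
     (sqint mu (fun x => smooth (avg (P k)) (f (m k)) x - f (m k) x)%R <= (4^-1 ^+ k)%:E)%E &
     forall P' m' x, prob_on (st k.+1).1 P' -> ((st k.+1).2 <= m')%N ->
      `|smooth (avg P') (f m') x - smooth (avg (P k)) (f (m k)) x| <=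
      smooth (avg P') (f m') 0 - smooth (avg (P k)) (f (m k)) 0 + 2^-1 ^+ k].
  have := HF (k, st k) (st0 k); rewrite stS /P /m; case: (st k) => V M.
  by case: (F _) => -[[V' M'] P'] m' [[]].
pose psi k := smooth (avg (P k)) (f (m k)).
have mono k l : (k <= l)%N -> (st l).1 `<=` (st k).1 /\ ((st k).2 <= (st l).2)%N.
  elim: l => [|l IH]; first by rewrite leqn0 => /eqP ->.
  rewrite leq_eqVlt ltnS => /predU1P[->|/IH[sub le]]; first by split.
  have [[sub' le'] _ _ _] := spec l.
  by split; [exact: subset_trans sub' sub|exact: leq_trans le le'].
have psi_pd k : real_pd (psi k) by exact: real_pd_smooth.
have psi_uc k : unif_cont (psi k) by have [_ [PV _ _] _ _] := spec k; exact: unif_cont_smooth PV _.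
have psi1 k : psi k 0 <= 1.
  have [_ [PV _ _] _ _] := spec k; rewrite (le_trans (ler_norm _))//.
  by apply: (avg_smooth_norm_le PV) => x; rewrite (le_trans (pd_norm_le x (f_pd _))).
have [|phi phiP] := @uniform_cauchy_limit R G psi.
  apply: (almost_increasing_cauchy psi1) => k l x kl.
  (* The neighbourhoods shrink and the thresholds grow, so the output of step [l] is admissible in
     the inequality established at step [k]. *)
  have [_ _ _ H] := spec k; have [_ [PV Ml _] _ _] := spec l.
  have [sub le] := mono _ _ kl.
  by apply: H; [exact: prob_on_sub PV|exact: leq_trans le Ml].
exists phi, m, psi; split=> //; last 3 first.
- by move=> k; have [_ []] := spec k.
- by move=> k; exact: unif_cont_continuous.
- by move=> k; have [] := spec k.
have approx e : 0 < e -> exists k, forall x, `|phi x - psi k x| <= e.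
  by move=> /phiP[K KP]; exists K => x; exact: KP.
split.
- by apply: real_pd_approx => e /approx[k kP]; exists (psi k).
- by apply: unif_cont_approx => e /approx[k kP]; exists (psi k).
- apply/ler_addgt0Pr => e /approx[k /(_ 0)]; rewrite ler_norml => /andP[_].
  by have := psi1 k; lra.
Qed.

End sqint_cauchy.

(** * A member of the class with positive integral *)

Section extremal_class.
Context {R : realType} {G : topologicalZmodType}.
Variable mu : {measure set (borelT G) -> \bar R}.
Hypothesis hG : hausdorff_space G.
Hypothesis lG : locally_compact [set: G].
Hypothesis hmu : haar_measure mu.

Lemma integrable_indic_lty (A : set (borelT G)) : measurable A -> (mu A < +oo)%E ->
  mu.-integrable setT (fun x => (\1_A x : R)%:E).
Proof.
move=> mA Aoo; apply/integrableP; split; first exact/measurable_EFinP/measurable_indic.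
under eq_integral do rewrite /= ger0_norm ?indic_ge0//.
by rewrite integral_indic// setIT.
Qed.

(** The tube lemma applied to addition. *)
Lemma nbhs0_compact_translate (K U : set G) : compact K -> open U -> K `<=` U ->
  \forall x \near (0 : G), forall y, K y -> U (x + y).
Proof.
move=> /compact_near_coveringP cK oU KU.
apply: (cK _ (nbhs (0 : G)) (fun x y => U (x + y))) => y Ky.
have [|[A B] /= [A0 By] AB] := @add_continuous G (0, y) U.
  by apply: open_nbhs_nbhs; split=> //=; rewrite add0r; exact: KU.
by exists (B, A) => // -[z x] [Bz Ax]; exact: (AB (x, z)).
Qed.

(** * Overlaps of a compact set with its translates *)

Section overlap.
Variable U : set G.
Hypothesis cU : compact U.

Let mU : measurable (U : set (borelT G)).
Proof. by apply: closed_borel; exact: compact_closed. Qed.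

Let muU : (mu U < +oo)%E.
Proof. by have [_ + _ _ _] := hmu; exact. Qed.

(** The translate [x + U], written as a preimage so that its measurability is that of a
    translation. *)
Let tr (x : G) : set (borelT G) := (fun y : G => - x + y) @^-1` U.

Let mtr x : measurable (tr x).
Proof. by rewrite -[tr x]setTI; exact: translation_borel. Qed.

Let mu_tr x : mu (tr x) = mu U.
Proof. exact: haar_preimage. Qed.

(** The autocorrelation of the indicator function of [U]. *)
Definition overlap (x : G) : R := fine (mu ((U : set (borelT G)) `&` tr x)).

Let overlapE x y : mu (tr x `&` tr y) = (overlap (x - y))%:E.
Proof.
rewrite fineK; last first.
  by rewrite ge0_fin_numE//; apply: le_lt_trans muU; apply: le_measure; rewrite ?inE//;
    exact: measurableI.
rewrite -(haar_preimage hmu y); last exact: measurableI.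
congr (mu _); apply/seteqP; split=> z; rewrite /tr /= addKr opprB addrA => -[? ?]; split=> //;
  by rewrite ?[y - x]addrC// [- x + y]addrC.
Qed.

Let tr0 : tr 0 = U.
Proof. by apply/seteqP; split=> z; rewrite /tr /= oppr0 add0r. Qed.

(** The quadratic form is the integral of the square of the combination [h] of indicators of
    translates of [U]. *)
Lemma overlap_pd : real_pd overlap.
Proof.
split=> [x|I c g].
  apply: EFin_inj; rewrite -sub0r -overlapE tr0 /overlap fineK// ge0_fin_numE//.
  by apply: le_lt_trans muU; apply: le_measure; rewrite ?inE//; exact: measurableI.
pose h (x : borelT G) : R := \sum_i c i * \1_(tr (g i)) x.
have h2 x : (h x) ^+ 2 = \sum_i \sum_j c i * c j * \1_(tr (g i) `&` tr (g j)) x.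
  rewrite expr2 /h mulr_suml; apply: eq_bigr => i _; rewrite mulr_sumr.
  by apply: eq_bigr => j _; rewrite indicI/=; ring.
have ii i j : mu.-integrable setT (fun x => (c i * c j * \1_(tr (g i) `&` tr (g j)) x)%:E).
  have -> : (fun x => (c i * c j * \1_(tr (g i) `&` tr (g j)) x)%:E) =
    (fun x => (c i * c j)%:E * (\1_(tr (g i) `&` tr (g j)) x)%:E)%E.
    by apply/funext => x; rewrite EFinM.
  apply: integrableZl => //; apply: integrable_indic_lty; first exact: measurableI.
  by rewrite overlapE ltry.
rewrite -lee_fin.
have <- : (\int[mu]_x ((h x) ^+ 2)%:E)%E = (\sum_i \sum_j c i * c j * overlap (g i - g j))%:E.
  transitivity (\int[mu]_x (\sum_i \sum_j (c i * c j * \1_(tr (g i) `&` tr (g j)) x)%:E))%E.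
    apply: eq_integral => x _; rewrite h2 -sumEFin; apply: eq_bigr => i _.
    by rewrite -sumEFin.
  rewrite integral_sum// => [|i]; last exact: integrable_sum.
  rewrite -sumEFin; apply: eq_bigr => i _; rewrite integral_sum// -sumEFin.
  apply: eq_bigr => j _; under eq_integral do rewrite EFinM.
  rewrite integralZl//; last first.
    by apply: integrable_indic_lty; [exact: measurableI|rewrite overlapE ltry].
  rewrite integral_indic//; last exact: measurableI.
  by rewrite setIT overlapE EFinM.
by apply: integral_ge0 => x _; rewrite lee_fin sqr_ge0.
Qed.

Lemma overlap0 : overlap 0 = fine (mu U).
Proof. by rewrite /overlap tr0 setIid. Qed.

(** Outer regularity gives an open [B] around [U] with excess at most [e]. For [x] near [0] the
    translate stays in [B], so its part outside [U] has measure at most [e], while its total measure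
    is that of [U]. *)
Lemma overlap_continuous0 : {for 0, continuous overlap}.
Proof.
apply/cvgrPdist_le => e e0; have [_ _ outer _ _] := hmu.
have Ufin : mu U \is a fin_num by rewrite ge0_fin_numE.
have [|_ [B [oB UB] <-] Be] := @lb_ereal_inf_adherent R
    [set mu B | B in [set B : set G | open B /\ U `<=` B]] e e0.
  by rewrite -outer.
rewrite -outer// in Be.
have mB : measurable (B : set (borelT G)) by exact: open_borel.
have B_fin : (mu B < +oo)%E by apply: lt_trans Be _; rewrite lte_add_pinfty// ltry.
have BU : (mu ((B : set (borelT G)) `\` U) <= e%:E)%E.
  by rewrite measureD// setIC (setIidl UB) leeBlDr// addeC ltW.
apply: filterS (nbhs0_compact_translate cU oB UB) => x xB.
have trB : tr x `<=` B.
  by move=> y Uxy; have := xB _ Uxy; rewrite addrA addrN add0r.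
have lo : overlap x <= fine (mu U).
  apply: fine_le => //; first by rewrite ge0_fin_numE//; apply: le_lt_trans muU;
    apply: le_measure; rewrite ?inE//; exact: measurableI.
  by apply: le_measure; rewrite ?inE//; exact: measurableI.
have hi : fine (mu U) <= e + overlap x.
  rewrite -lee_fin fineK// EFinD -[leLHS](mu_tr x) (measureDI mu (mtr x) mU).
  apply: leeD.
    apply: le_trans BU; apply: le_measure; rewrite ?inE; try exact: measurableD.
    by move=> y [/trB].
  rewrite setIC /overlap fineK// ge0_fin_numE//.
  by apply: le_lt_trans muU; apply: le_measure; rewrite ?inE//; exact: measurableI.
by rewrite overlap0 ger0_norm ?subr_ge0// lerBlDr.
Qed.

End overlap.

Lemma GG_le_indic (Omega : set G) (f : G -> R) x : GG mu Omega f -> f x <= \1_Omega x.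
Proof.
move=> [[_ /positive_definiteP pf f01] _ fO]; rewrite indicE.
have [xO|nxO] := boolP (x \in Omega); first by rewrite -f01 (le_trans (ler_norm _))// pd_norm_le.
rewrite leNgt; apply/negP => fx; move/negP: nxO; apply; apply/mem_set/fO/subset_closure.
by rewrite /= /fplus max_l ?gt_eqF// ltW.
Qed.

Lemma supp_fplus_sub (Omega : set G) (f : G -> R) : closed Omega ->
  (forall x, ~ Omega x -> f x <= 0) -> supp (fplus f) `<=` Omega.
Proof.
move=> cO f0; rewrite /supp [X in _ `<=` X](closure_id Omega).1//; apply: closureS => x /= /eqP fx.
by apply: contrapT => nO; apply: fx; rewrite /fplus max_r// f0.
Qed.

(** The witness is the normalized autocorrelation of a compact neighbourhood [U] of [0] whose
    differences lie in [Omega]. It is nonnegative, vanishes outside [Omega], and is at least [1 / 2]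
    near [0]. *)
Lemma exists_GG (Omega : set G) : closed Omega -> nbhs (0 : G) Omega ->
  (mu Omega < +oo)%E -> exists2 f, GG mu Omega f & (0 < \int[mu]_x (f x)%:E)%E.
Proof.
move=> cO O0 Ooo; have [W W0 WO] := nbhs0_sub O0.
have [U [cU clU UW] U0] := compact_nbhs hG lG W0.
have mU := closed_borel clU.
have Uoo : (mu U < +oo)%E by have [_ + _ _ _] := hmu; exact.
have m0 : 0 < fine (mu U) by rewrite fine_gt0// Uoo andbT; apply: haar_nbhs_gt0.
set m := fine (mu U) in m0.
have mi0 : 0 <= m^-1 by rewrite invr_ge0 ltW.
pose f x := m^-1 * overlap U x.
have fpd : real_pd f by apply: real_pdZ => //; exact: overlap_pd.
have f1 : f 0 = 1 by rewrite /f overlap0 mulVf ?gt_eqF.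
have fc0 : {for 0, continuous f}.
  by apply: cvgMr; exact: overlap_continuous0.
have fuc : unif_cont f by apply: pd_unif_cont => //; rewrite f1.
have fc : continuous f by exact: unif_cont_continuous.
have f_ge0 x : 0 <= f x by rewrite mulr_ge0// fine_ge0.
have f_out x : ~ Omega x -> f x = 0.
  move=> nO; rewrite /f /overlap [X in mu X](_ : _ = set0) ?measure0 ?mulr0//.
  rewrite -subset0 => y [Uy Uxy]; apply: nO.
  by have := WO _ _ (UW _ Uxy) (UW _ Uy); rewrite opprD opprK addrCA subrr addr0.
have mf := continuous_borel fc.
have fint : mu.-integrable setT (fun x : borelT G => (f x)%:E).
  apply: (@le_integrable _ _ _ mu setT measurableT _ (fun x : borelT G => (\1_Omega x : R)%:E)).
  - exact/measurable_EFinP.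
  - move=> x _ /=; rewrite lee_fin !ger0_norm ?indic_ge0// indicE.
    have [xO|/negP nxO] := boolP (x \in Omega).
      by rewrite -f1 (le_trans (ler_norm _))// pd_norm_le.
    by rewrite f_out// => Ox; apply: nxO; exact: mem_set.
  - by apply: integrable_indic_lty => //; exact: closed_borel.
exists f.
  split=> //; first by split=> //; exact/positive_definiteP.
  by apply: supp_fplus_sub => // x nO; rewrite f_out.
have := fc0; move=> /cvgrPdist_le /(_ 2^-1); rewrite invr_gt0 ltr0n => /(_ isT).
rewrite -/(nbhs _ _) nbhsE => -[B [oB B0] Bf].
have mB := open_borel oB.
apply: (@lt_le_trans _ _ (\int[mu]_(x in B) (2^-1)%:E)%E).
  rewrite integral_cst// mule_gt0// ?lte_fin ?invr_gt0//.
  by apply: haar_open_gt0 => //; exists 0.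
apply: (@le_trans _ _ (\int[mu]_(x in B) (f x)%:E)%E).
  apply: ge0_le_integral => //.
  - by apply: measurable_funTS; exact/measurable_EFinP.
  - move=> x /Bf /=; rewrite f1 lee_fin ler_norml => /andP[_]; lra.
apply: ge0_subset_integral => //; first exact/measurable_EFinP.
by move=> x _; rewrite lee_fin.
Qed.

End extremal_class.

(** * The maximizing sequence *)

Section extremal.
Context {R : realType} {G : topologicalZmodType}.
Variable mu : {measure set (borelT G) -> \bar R}.
Variable Omega : set G.
Hypothesis cO : closed Omega.
Hypothesis Ooo : (mu Omega < +oo)%E.
Implicit Types (f g : G -> R).

Let mO : measurable (Omega : set (borelT G)).
Proof. exact: closed_borel. Qed.

Let muO : mu Omega \is a fin_num.
Proof. by rewrite ge0_fin_numE. Qed.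

Let iO : mu.-integrable setT (fun x : borelT G => (\1_Omega x : R)%:E).
Proof. exact: integrable_indic_lty. Qed.

Let intO : (\int[mu]_x (\1_Omega x : R)%:E)%E = mu Omega.
Proof. by rewrite integral_indic// setIT. Qed.

Lemma GG_bounded f x : GG mu Omega f -> `|f x| <= 1.
Proof. by move=> [[_ /positive_definiteP pf <-] _ _]; exact: pd_norm_le. Qed.

Lemma GG_measurable f : GG mu Omega f -> measurable_fun [set: borelT G] (f : borelT G -> R).
Proof. by move=> [[cf _ _] _ _]; exact: continuous_borel. Qed.

Lemma GG_integral_le f : GG mu Omega f -> (\int[mu]_x (f x)%:E <= mu Omega)%E.
Proof.
move=> fG; have [_ fi _] := fG; rewrite -intO; apply: le_integral => // x _.
by rewrite lee_fin; exact: GG_le_indic fG.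
Qed.

Lemma GG_integral_fin_num f : GG mu Omega f -> (\int[mu]_x (f x)%:E)%E \is a fin_num.
Proof. by move=> [_ fi _]; exact: integrable_fin_num. Qed.

Lemma GG_integral_le_DD f : GG mu Omega f -> (\int[mu]_x (f x)%:E <= DD mu Omega)%E.
Proof. by move=> fG; apply: ereal_sup_ubound; exists f. Qed.

Lemma DD_le : (DD mu Omega <= mu Omega)%E.
Proof. by apply: ge_ereal_sup => _ [f fG <-]; exact: GG_integral_le. Qed.

(** Pointwise [f^2 <= 2 1_Omega - f]: on [Omega] because [|f| <= 1], and elsewhere because
    [-1 <= f <= 0]. The nonnegative integral of [f] is then dropped. *)
Lemma GG_sqint_le f : GG mu Omega f -> (0 <= \int[mu]_x (f x)%:E)%E ->
  (sqint mu f <= 2%:E * mu Omega)%E.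
Proof.
move=> fG f0; have [_ fi _] := fG; have mf := GG_measurable fG.
have i2 : mu.-integrable setT (fun x : borelT G => (2%:E * (\1_Omega x : R)%:E)%E).
  exact: integrableZl.
apply: (@le_trans _ _ (\int[mu]_x (2%:E * (\1_Omega x : R)%:E - (f x)%:E))%E).
  apply: ge0_le_integral => //.
  - by move=> x _; rewrite lee_fin sqr_ge0.
  - exact: measurable_sq.
  - apply: emeasurable_funB; last exact/measurable_EFinP.
    by apply: measurable_funeM; apply/measurable_EFinP; exact: measurable_indic.
  - move=> x _; rewrite -EFinM -EFinB lee_fin.
    have fx := GG_le_indic x fG; have := GG_bounded x fG; rewrite ler_norml => /andP[f1 f1'].
    by move: fx; rewrite indicE; case: (x \in Omega) => /= fx; nra.
rewrite integralB// integralZl// intO.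
by rewrite leeBlDr// ?leeDl// GG_integral_fin_num.
Qed.

Lemma GG_sqint_fin_num f : GG mu Omega f -> (0 <= \int[mu]_x (f x)%:E)%E ->
  sqint mu f \is a fin_num.
Proof.
move=> fG f0; rewrite ge0_fin_numE; last first.
  by apply: integral_ge0 => x _; rewrite lee_fin sqr_ge0.
apply: le_lt_trans (GG_sqint_le fG f0) _.
by rewrite -(fineK muO) -EFinM ltry.
Qed.

Lemma GG_mid f g : GG mu Omega f -> GG mu Omega g ->
  GG mu Omega (fun x => (f x + g x) / 2).
Proof.
move=> fG gG; have [[cf /positive_definiteP pf f1] fi _] := fG.
have [[cg /positive_definiteP pg g1] gi _] := gG; split.
- split; [|apply/positive_definiteP|by rewrite f1 g1; field].
    by move=> x; apply: cvgMl; apply: cvgD; [exact: cf|exact: cg].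
  have -> : (fun x => (f x + g x) / 2) = (fun x => 2^-1 * (f x + g x)).
    by apply/funext => x; rewrite mulrC.
  by apply: real_pdZ; [rewrite invr_ge0|exact: real_pdD].
- have -> : (fun x : borelT G => ((f x + g x) / 2)%:E) =
      (fun x : borelT G => (2^-1)%:E * ((f x)%:E + (g x)%:E))%E.
    by apply/funext => x; rewrite mulrC EFinM EFinD.
  by apply: integrableZl => //; exact: integrableD.
- apply: supp_fplus_sub => // x nO; rewrite pmulr_lle0 ?invr_gt0//.
  have := GG_le_indic x fG; have := GG_le_indic x gG.
  by rewrite indicE memNset// => ? ?; rewrite -[leRHS]addr0 lerD.
Qed.

Lemma integral_mid f g : GG mu Omega f -> GG mu Omega g ->
  (\int[mu]_x ((f x + g x) / 2)%:E)%E =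
  ((2^-1)%:E * (\int[mu]_x (f x)%:E + \int[mu]_x (g x)%:E))%E.
Proof.
move=> [_ fi _] [_ gi _]; rewrite -integralD// -integralZl//; last exact: integrableD.
by apply: eq_integral => x _; rewrite mulrC EFinM EFinD.
Qed.

(* Nearly minimal L2 norm in the convex sets of nearly extremal functions:
   by the parallelogram law such functions are close in L2. *)
Lemma minimizing_sequence (d : R) : DD mu Omega = d%:E -> 0 < d ->
  exists f : nat -> G -> R, [/\ forall n, GG mu Omega (f n),
    forall n, ((d - d * 2^-1 ^+ n)%:E <= \int[mu]_x (f n x)%:E)%E &
    forall e : R, 0 < e -> exists N, forall m n, (N <= m)%N -> (N <= n)%N ->
      (sqint mu (fun x => f m x - f n x)%R <= e%:E)%E].
Proof.
move=> Dd d0.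
have p0 k : 0 < 2^-1 ^+ k :> R by rewrite exprn_gt0// invr_gt0.
have p1 k : 2^-1 ^+ k <= 1 :> R by rewrite exprn_ile1// ?invr_ge0// invf_le1// ler1n.
have pm k l : (k <= l)%N -> 2^-1 ^+ l <= 2^-1 ^+ k :> R.
  by move=> kl; apply: ler_wiXn2l; rewrite ?invr_ge0// invf_le1// ler1n.
(* The slack never exceeds [d], so members of [S k] have nonnegative integral, which bounds their L2
   norms. The sets decrease with [k]. *)
pose S k := [set f | GG mu Omega f /\ ((d - d * 2^-1 ^+ k)%:E <= \int[mu]_x (f x)%:E)%E].
have S_ge0 k f : S k f -> (0 <= \int[mu]_x (f x)%:E)%E.
  move=> [_]; apply: le_trans; rewrite lee_fin subr_ge0.
  by rewrite -[leRHS]mulr1 ler_pM2l.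
have SS k l : (k <= l)%N -> S l `<=` S k.
  move=> kl f [fG fl]; split=> //; apply: le_trans fl.
  by rewrite lee_fin lerD2l lerN2 ler_pM2l// pm.
have S0 k : exists f, S k f.
  have [||_ [f fG <-] fd] := @ub_ereal_sup_adherent R
      [set (\int[mu]_x (f x)%:E)%E | f in GG mu Omega] (d * 2^-1 ^+ k).
  - by rewrite mulr_gt0.
  - by rewrite -/(DD mu Omega) Dd.
  rewrite -/(DD mu Omega) Dd -EFinB in fd.
  by exists f; split=> //; exact: ltW.
have qE k f : S k f -> sqint mu f = (fine (sqint mu f))%:E.
  by move=> fS; rewrite fineK//; apply: GG_sqint_fin_num; [exact: fS.1|exact: S_ge0 fS].
have q0 f : 0 <= fine (sqint mu f).
  by rewrite fine_ge0//; apply: integral_ge0 => x _; rewrite lee_fin sqr_ge0.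
pose Q k := [set fine (sqint mu f) | f in S k].
have Qinf k : has_inf (Q k).
  by split; [have [f fS] := S0 k; exists (fine (sqint mu f)), f|exists 0 => _ [f _ <-]].
(* The infima do not decrease with [k], so their supremum is the limiting minimal squared norm. *)
pose I := [set inf (Q k) | k in [set: nat]].
have Isup : has_sup I.
  split; first by exists (inf (Q 0%N)), 0%N.
  exists (2 * fine (mu Omega)) => _ [k _ <-]; have [f fS] := S0 k.
  apply: (@le_trans _ _ (fine (sqint mu f))).
    by apply: ge_inf; [exact: (Qinf k).2|exists f].
  rewrite -lee_fin -(qE k)// EFinM fineK//; apply: GG_sqint_le; first exact: fS.1.
  exact: S_ge0 fS.
have next k : exists f, S k f /\ fine (sqint mu f) < inf (Q k) + 2^-1 ^+ k.
  by have [_ [f fS <-] fk] := inf_adherent (p0 k) (Qinf k); exists f.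
have [f fS] := choice next.
exists f; split=> [n|n|e e0]; [exact: (fS n).1.1|exact: (fS n).1.2|].
have e8 : 0 < e / 8 by rewrite divr_gt0.
have [_ [K _ <-] HK] := sup_adherent e8 Isup.
have : (fun n => 2^-1 ^+ n : R) @ \oo --> (0 : R).
  by apply: cvg_expr; rewrite ger0_norm ?invr_ge0// invf_lt1// ltr1n.
move=> /cvgrPdist_le /(_ _ e8)[N _ Nsmall].
have qle n : (maxn K N <= n)%N -> S K (f n) /\ fine (sqint mu (f n)) <= sup I + e / 8.
  rewrite geq_max => /andP[Kn Nn]; have [fnS fnq] := fS n; split; first exact: SS Kn _ fnS.
  apply: le_trans (ltW fnq) _; apply: lerD; first by apply: ub_le_sup; [exact: Isup.2|exists n].
  by have := Nsmall n Nn; rewrite /= sub0r normrN (ger0_norm (ltW (p0 n))).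
exists (maxn K N) => m n /qle[mS mq] /qle[nS nq].
have midS : S K (fun x => (f m x + f n x) / 2).
  split; first exact: GG_mid mS.1 nS.1.
  rewrite (integral_mid mS.1 nS.1).
  have -> : (d - d * 2^-1 ^+ K)%:E =
     ((2^-1)%:E * ((d - d * 2^-1 ^+ K)%:E + (d - d * 2^-1 ^+ K)%:E))%E.
    by rewrite -EFinD -EFinM; congr EFin; field.
  by apply: lee_wpmul2l; [rewrite lee_fin invr_ge0|apply: leeD; [exact: mS.2|exact: nS.2]].
(* The midpoint stays in [S K], so its squared norm is at least [inf (Q K)]. The parallelogram law
   then leaves at most [4 (e / 8) + 4 (e / 8) = e] for the difference. *)
have midq : sup I - e / 8 <= fine (sqint mu (fun x => (f m x + f n x) / 2)).
  apply: le_trans (ltW HK) _; apply: ge_inf; first exact: (Qinf K).2.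
  by exists (fun x => (f m x + f n x) / 2).
have := sqint_parallelogram mu (GG_measurable mS.1) (GG_measurable nS.1).
rewrite (qE _ _ mS) (qE _ _ nS) (qE _ _ midS).
move: mq nq midq; set a := fine (sqint mu (f m)); set b := fine (sqint mu (f n)).
set c := fine _; set q := sqint mu _; set i := sup I => mq nq midq.
rewrite -!EFinM -EFinD => /(congr1 (fun z => z - (4 * c)%:E)%E).
rewrite addeK// => ->; rewrite -EFinB lee_fin; lra.
Qed.

End extremal.

(** * The limit function *)

Section limn_einf_bounds.
Context {R : realType}.
Implicit Types (u : nat -> \bar R) (l : R).

Let limn_einfE u : limn_einf u = ereal_sup (range (einfs u)).
Proof. by rewrite limn_einf_lim; apply/cvg_lim => //; exact: cvg_einfs_sup. Qed.

Lemma limn_einf_ge u l : (forall e : R, 0 < e ->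
    exists N, forall n, (N <= n)%N -> ((l - e)%:E <= u n)%E) ->
  (l%:E <= limn_einf u)%E.
Proof.
move=> ul; apply/lee_addgt0Pr => e e0; have [N uN] := ul e e0.
rewrite -leeBlDr// -EFinB limn_einfE.
apply: (@le_trans _ _ (einfs u N)); last by apply: ereal_sup_ubound; exists N.
by apply: le_ereal_inf_tmp => _ [n /= Nn <-]; exact: uN.
Qed.

Lemma limn_einf_le u l : (forall e : R, 0 < e ->
    exists N, forall n, (N <= n)%N -> (u n <= (l + e)%:E)%E) ->
  (limn_einf u <= l%:E)%E.
Proof.
move=> ul; apply/lee_addgt0Pr => e e0; have [N uN] := ul e e0.
rewrite limn_einfE -EFinD; apply: ge_ereal_sup => _ [n _ <-].
apply: le_trans (uN (maxn n N) (leq_maxr _ _)).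
by apply: ereal_inf_lbound; exists (maxn n N) => //=; exact: leq_maxl.
Qed.

Lemma geometric_small (a e : R) : 0 < e -> exists N, forall n, (N <= n)%N ->
  a * 2^-1 ^+ n <= e.
Proof.
move=> e0; have : (fun n => a * 2^-1 ^+ n : R) @ \oo --> (a * 0 : R).
  apply: cvgMr; apply: cvg_expr.
  by rewrite ger0_norm ?invr_ge0// invf_lt1// ltr1n.
rewrite mulr0 => /cvgrPdist_le /(_ _ e0)[N _ Nsmall]; exists N => n /Nsmall /=.
by rewrite sub0r normrN; apply: le_trans; exact: ler_norm.
Qed.

(** A quadratic penalty with a large factor [p] absorbs a linear term up to [p^-1]; the proof
    completes the square. *)
Lemma oppV_le_quadratic (p y : R) : 0 < p -> - p^-1 <= y + p * y ^+ 2.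
Proof.
move=> p0; rewrite -(ler_pM2r p0) mulNr mulVf ?gt_eqF//.
by have := sqr_ge0 (2 * p * y + 1); nra.
Qed.

End limn_einf_bounds.

(** * Sign and integral of the limit function *)

Section fatou.
Context {R : realType} {G : topologicalZmodType}.
Variable mu : {measure set (borelT G) -> \bar R}.
Hypothesis hG : hausdorff_space G.
Hypothesis hmu : haar_measure mu.
Variable Omega : set G.
Hypothesis cO : closed Omega.
Hypothesis Ooo : (mu Omega < +oo)%E.
Variables (phi : G -> R) (f psi : nat -> G -> R) (d : R).
Hypothesis phi_cont : continuous phi.
Hypothesis phi_le1 : forall x, phi x <= 1.
Hypothesis fG : forall k, GG mu Omega (f k).
Hypothesis f_int : forall k, ((d - d * 2^-1 ^+ k)%:E <= \int[mu]_x (f k x)%:E)%E.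
Hypothesis psi_cont : forall k, continuous (psi k).
Hypothesis psi_phi : forall e : R, 0 < e -> exists K, forall k x, (K <= k)%N ->
  `|phi x - psi k x| <= e.
Hypothesis psi_f : forall k,
  (sqint mu (fun x => psi k x - f k x)%R <= (4^-1 ^+ k)%:E)%E.

Let mO : measurable (Omega : set (borelT G)).
Proof. exact: closed_borel. Qed.

Let muO : mu Omega \is a fin_num.
Proof. by rewrite ge0_fin_numE. Qed.

Let m1O : measurable_fun [set: borelT G] (\1_Omega : borelT G -> R).
Proof. exact: measurable_indic. Qed.

Let iO : mu.-integrable setT (fun x : borelT G => (\1_Omega x : R)%:E).
Proof. exact: integrable_indic_lty. Qed.

Let mphi : measurable_fun [set: borelT G] (phi : borelT G -> R).
Proof. exact: continuous_borel. Qed.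

Let mf k : measurable_fun [set: borelT G] (f k : borelT G -> R).
Proof. exact: GG_measurable (fG k). Qed.

Let mpsi k : measurable_fun [set: borelT G] (psi k : borelT G -> R).
Proof. exact: continuous_borel. Qed.

(** Were [phi x] positive, then on an open nonempty set [B] outside [Omega] eventually [psi k >= r]
    while [f k <= 0]. The squared L2 distance would stay above [r^2 mu B], against its convergence
    to 0. *)
Lemma limit_le0 x : ~ Omega x -> phi x <= 0.
Proof.
move=> nOx; rewrite leNgt; apply/negP => phix.
pose r := phi x / 4.
have r0 : 0 < r by rewrite divr_gt0.
pose B := ~` Omega `&` phi @^-1` [set y : R | 2 * r < y].
have oB : open B.
  apply: openI; first exact: closed_openC.
  by move/continuousP: phi_cont; apply; exact: open_gt.
have mB := open_borel oB.
have B0 : (0 < mu B)%E.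
  apply: haar_open_gt0 => //; exists x; split=> //=; rewrite /r.
  by rewrite mulrCA gtr_pMr// ltr_pdivrMr// mul1r ltr_nat.
have [K psiK] := psi_phi r0.
suff : ((r ^+ 2)%:E * mu B <= 0)%E.
  by rewrite leNgt mule_gt0// lte_fin exprn_gt0.
apply/lee_addgt0Pr => e e0; rewrite add0e.
have [N Nsmall] := geometric_small 1 e0.
pose k := maxn K N.
apply: (@le_trans _ _ (4^-1 ^+ k)%:E); last first.
  rewrite lee_fin; apply: le_trans (Nsmall k (leq_maxr _ _)); rewrite mul1r.
  by rewrite lerXn2r ?nnegrE ?invr_ge0// lef_pV2 ?posrE// ler_nat.
apply: le_trans (psi_f k).
apply: (@le_trans _ _ (\int[mu]_(y in B) ((psi k y - f k y) ^+ 2)%:E)%E); last first.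
  apply: ge0_subset_integral => //.
    by apply: measurable_sq; exact: measurable_funB.
  by move=> y _; rewrite lee_fin sqr_ge0.
rewrite -integral_cst//; apply: ge0_le_integral => //.
- by move=> y _; rewrite lee_fin sqr_ge0.
- by apply: measurable_funTS; apply: measurable_sq; exact: measurable_funB.
- move=> y [nOy /= phiy]; rewrite lee_fin lerXn2r ?nnegrE ?(ltW r0)//.
    have := psiK k y (leq_maxl _ _); have := GG_le_indic y (fG k).
    rewrite indicE memNset//= ler_norml => fy /andP[_].
    move: r0 phiy fy; lra.
  have := psiK k y (leq_maxl _ _); have := GG_le_indic y (fG k).
  rewrite indicE memNset//= ler_norml => fy /andP[_].
  move: r0 phiy fy; lra.
Qed.

Let phi_le x : phi x <= \1_Omega x.
Proof.
rewrite indicE; have [_|nO] := boolP (x \in Omega); first exact: phi_le1.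
by apply: limit_le0 => /mem_set; exact/negP.
Qed.

(** The functions [f k] need not converge pointwise. The penalty term lets [h k] bound
    [1_Omega - psi k] from above up to [2^-k], while its integral is at most [2^k 4^-k = 2^-k]. *)
Let h k x : R := \1_Omega x - f k x + 2 ^+ k * (psi k x - f k x) ^+ 2.

Let h_ge x k : \1_Omega x - psi k x - 2^-1 ^+ k <= h k x.
Proof.
rewrite /h; have p0 : 0 < 2 ^+ k :> R by rewrite exprn_gt0.
have -> : 2^-1 ^+ k = (2 ^+ k)^-1 :> R by rewrite exprVn.
move: (2 ^+ k) p0 => p p0; set y := psi k x - f k x.
have -> : \1_Omega x - f k x = \1_Omega x - psi k x + y by rewrite /y; ring.
by move: y => y; rewrite -!addrA lerD2l lerD2l; exact: oppV_le_quadratic.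
Qed.

Let int_h k : (\int[mu]_x (h k x)%:E <= (fine (mu Omega) - d + (d + 1) * 2^-1 ^+ k)%:E)%E.
Proof.
have ge1 x : 0 <= \1_Omega x - f k x by rewrite subr_ge0; exact: GG_le_indic (fG k).
have [_ fi _] := fG k.
have -> : (\int[mu]_x (h k x)%:E = \int[mu]_x ((\1_Omega x - f k x)%:E +
    (2 ^+ k)%:E * ((psi k x - f k x) ^+ 2)%:E))%E.
  by apply: eq_integral => x _; rewrite -EFinM -EFinD.
have mq : measurable_fun [set: borelT G] (fun x : borelT G => ((psi k x - f k x) ^+ 2)%:E).
  by apply: (@measurable_sq _ _ (fun x => psi k x - f k x)); exact: measurable_funB.
rewrite ge0_integralD//; last 4 first.
- by move=> x _; rewrite lee_fin.
- by apply/measurable_EFinP; exact: measurable_funB.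
- by move=> x _; rewrite mule_ge0// lee_fin ?sqr_ge0// exprn_ge0.
- exact: measurable_funeM.
rewrite ge0_integralZl_EFin//; last by move=> x _; rewrite lee_fin sqr_ge0.
have -> : (\int[mu]_x (\1_Omega x - f k x)%:E = mu Omega - \int[mu]_x (f k x)%:E)%E.
  have -> : mu Omega = (\int[mu]_x (\1_Omega x : R)%:E)%E by rewrite integral_indic// setIT.
  by rewrite -integralB.
have -> : fine (mu Omega) - d + (d + 1) * 2^-1 ^+ k =
  fine (mu Omega) - (d - d * 2^-1 ^+ k) + 2 ^+ k * 4^-1 ^+ k.
  have -> : 4^-1 = 2^-1 * 2^-1 :> R by field.
  by rewrite exprMn mulrA -exprMn mulfV// expr1n; ring.
rewrite EFinD; apply: leeD.
  by rewrite EFinB fineK//; apply: leeB.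
by rewrite EFinM; apply: lee_wpmul2l; [rewrite lee_fin exprn_ge0|exact: psi_f].
Qed.

(** Uniform convergence of [psi k] puts [1_Omega - phi] below the lower limit of the nonnegative
    functions [h k], and Fatou's lemma bounds the integral of that lower limit. *)
Let int_gap : (\int[mu]_x (\1_Omega x - phi x)%:E <= (fine (mu Omega) - d)%:E)%E.
Proof.
have h0 k x : 0 <= h k x.
  apply: addr_ge0; first by rewrite subr_ge0; exact: GG_le_indic (fG k).
  by apply: mulr_ge0; rewrite ?sqr_ge0 ?exprn_ge0.
have mh k : measurable_fun [set: borelT G] (fun x : borelT G => (h k x)%:E).
  apply/measurable_EFinP; apply: measurable_funD; first exact: measurable_funB.
  by apply: measurable_funM => //; apply: measurable_funX; exact: measurable_funB.
apply: (@le_trans _ _ (\int[mu]_x limn_einf (fun k => (h k x)%:E))%E).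
  apply: ge0_le_integral => //.
  - by move=> x _; rewrite lee_fin subr_ge0.
  - by apply/measurable_EFinP; exact: measurable_funB.
  - apply: (emeasurable_fun_cvg (fun n (x : borelT G) => einfs (fun k => (h k x)%:E) n)).
      by move=> n; exact: measurable_fun_einfs.
    by move=> x _; rewrite limn_einf_lim; exact: is_cvg_einfs.
  - move=> x _; apply: limn_einf_ge => e e0.
    have e2 : 0 < e / 2 by rewrite divr_gt0.
    have [K psiK] := psi_phi e2; have [N Nsmall] := geometric_small 1 e2.
    exists (maxn K N) => k; rewrite geq_max => /andP[Kk Nk].
    rewrite lee_fin; apply: le_trans (h_ge x k).
    have := psiK k x Kk; have := Nsmall k Nk; rewrite mul1r ler_norml.
    move: (2^-1 ^+ k) (\1_Omega x) (phi x) (psi k x) => a b c c' ? /andP[? ?]; lra.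
apply: (le_trans (fatou mu measurableT mh (fun k x _ => h0 k x))).
apply: limn_einf_le => e /(geometric_small (d + 1))[N Nsmall].
exists N => k Nk; apply: le_trans (int_h k) _.
by rewrite lee_fin lerD2l; exact: Nsmall.
Qed.

(** The nonnegative gap [1_Omega - phi] has finite integral, so [phi] is a difference of integrable
    functions. *)
Lemma limit_integrable : mu.-integrable setT (fun x : borelT G => (phi x)%:E) /\
  (d%:E <= \int[mu]_x (phi x)%:E)%E.
Proof.
have ig : mu.-integrable setT (fun x : borelT G => (\1_Omega x - phi x)%:E).
  apply/integrableP; split; first by apply/measurable_EFinP; exact: measurable_funB.
  apply: le_lt_trans (ltry (fine (mu Omega) - d)); apply: le_trans int_gap.
  by under eq_integral do rewrite /= ger0_norm ?subr_ge0//.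
have phiE : (fun x : borelT G => (phi x)%:E) =
    (fun x : borelT G => (\1_Omega x : R)%:E - (\1_Omega x - phi x)%:E)%E.
  by apply/funext => x; rewrite -EFinB; congr EFin; ring.
rewrite phiE; split; first exact: integrableB.
rewrite integralB// integral_indic// setIT.
rewrite leeBrDl; last exact: integrable_fin_num.
rewrite -leeBrDr// -[mu _]fineK// -EFinB; exact: int_gap.
Qed.

End fatou.

(** * Normalization of the limit to an extremal function *)

Theorem theorem9 (R : realType) (G : topologicalZmodType)
    (mu : {measure set (borelT G) -> \bar R}) (Omega : set G) :
  hausdorff_space G -> locally_compact [set: G] -> haar_measure mu ->
  closed Omega -> nbhs (0 : G) Omega -> (mu Omega < +oo)%E ->
  exists f : G -> R,
    [/\ GG mu Omega f,
        (\int[mu]_x (f x)%:E)%E = DD mu Omega &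
        exists fn : nat -> G -> R,
          [/\ forall n, GG mu Omega (fn n),
              (fun n => (\int[mu]_x (fn n x)%:E)%E) @ \oo --> DD mu Omega &
              forall K : set G, compact K ->
                forall e : R, 0 < e ->
                  \forall n \near \oo, forall x, K x -> `|fn n x - f x| < e]].
Proof.
move=> hG lG hmu cO O0 Ooo.
have [f0 f0G f0_gt0] := exists_GG hG lG hmu cO O0 Ooo.
have D_gt0 : (0 < DD mu Omega)%E by apply: lt_le_trans f0_gt0 _; exact: GG_integral_le_DD.
have [d DDd] : exists d, DD mu Omega = d%:E.
  exists (fine (DD mu Omega)); rewrite fineK// ge0_fin_numE ?ltW//.
  exact: le_lt_trans (DD_le cO Ooo) Ooo.
have d0 : 0 < d by rewrite DDd lte_fin in D_gt0.
have [f [fG f_int f_cauchy]] := minimizing_sequence cO Ooo DDd d0.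
have f_pd n : real_pd (f n) by have [[_ /positive_definiteP]] := fG n.
have f_1 n : f n 0 <= 1 by have [[_ _ ->]] := fG n.
have f_uc n : unif_cont (f n).
  by have [[cf _ _] _ _] := fG n; apply: pd_unif_cont => //; exact: cf.
have f_i n : mu.-integrable setT (fun x : borelT G => (f n x)%:E) by have [] := fG n.
have [phi [m [psi [[phi_pd phi_uc phi_1] m_ge psi_cont psi_phi psi_f]]]] :=
  sqint_cauchy_limit hG lG hmu f_pd f_uc f_1 f_i f_cauchy.
have phi_cont : continuous phi by exact: unif_cont_continuous.
have phi_le1 x : phi x <= 1.
  by rewrite (le_trans (ler_norm _))// (le_trans (pd_norm_le x phi_pd)).
have fm_int k : ((d - d * 2^-1 ^+ k)%:E <= \int[mu]_x (f (m k) x)%:E)%E.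
  apply: le_trans (f_int (m k)); rewrite lee_fin lerD2l lerN2 ler_pM2l//.
  by apply: ler_wiXn2l; rewrite ?invr_ge0// invf_le1// ler1n.
have phi_out := limit_le0 hG hmu cO phi_cont (fun k => fG (m k)) psi_cont psi_phi psi_f.
have [phi_int d_le] := limit_integrable hG hmu cO Ooo phi_cont phi_le1
  (fun k => fG (m k)) fm_int psi_cont psi_phi psi_f.
(* If [phi 0 <= 0], then [|phi x| <= phi 0] makes [phi] vanish, although its integral is at least
   [d > 0]. *)
have phi0 : 0 < phi 0.
  rewrite ltNge; apply/negP => phi0; move: d_le.
  have -> : phi = fun=> 0.
    apply/funext => x; apply/eqP; rewrite -normr_le0.
    exact: le_trans (pd_norm_le x phi_pd) phi0.
  by rewrite integral0 lee_fin leNgt d0.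
pose g x := (phi 0)^-1 * phi x.
have gG : GG mu Omega g.
  split.
  - split; [by move=> x; apply: cvgMr; exact: phi_cont| |by rewrite /g mulVf ?gt_eqF].
    by apply/positive_definiteP/real_pdZ => //; rewrite invr_ge0 ltW.
  - have -> : (fun x : borelT G => (g x)%:E) = (fun x : borelT G => (phi 0)^-1%:E * (phi x)%:E)%E.
      by apply/funext => x; rewrite EFinM.
    exact: integrableZl.
  - apply: supp_fplus_sub => // x /phi_out phix.
    by rewrite /g pmulr_rle0// invr_gt0.
have gD : (\int[mu]_x (g x)%:E)%E = DD mu Omega.
  (* As [phi 0 <= 1] and the integral of [phi] is positive, dividing by [phi 0] cannot lower the
     integral below [d]. *)
  apply/eqP; rewrite eq_le GG_integral_le_DD//= DDd.
  under eq_integral do rewrite EFinM.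
  rewrite integralZl//; apply: le_trans (d_le) _.
  rewrite -[leLHS]mul1e; apply: lee_wpmul2r; last by rewrite lee_fin invf_ge1.
  by apply: le_trans (d_le); rewrite lee_fin ltW.
exists g; split=> //; exists (fun=> g); split=> //.
  by rewrite gD; exact: cvg_cst.
by move=> K _ e e0; apply: nearW => n x _; rewrite subrr normr0.
Qed.
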